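(* Let $N>1$, let $f:\mathbb R^N\times\mathbb R\to\mathbb R^N$ be continuously differentiable, and let $\lambda:\mathbb R\to(\lambda_-,\lambda_+)$ be an asymptotically constant parameter shift. Let $(X(s),\lambda(s))$ be a stable path from $X_-$ to $X_+$. If the stable path $(X(s),\lambda(s))$ is forward inflowing stable, then for all $r>0$ the pullback attractor $\gamma_r$ to $X_-$ of the nonautonomous system $\dot x=f(x,\lambda(rt))$ is end-point tracking, i.e. $\lim_{t\to\infty}|\gamma_r(t)-X(rt)|=0$ (equivalently $\gamma_r(t)\to X_+$ as $t\to\infty$), and is (locally) forward attracting.
   Context: For $r>0$, $x(t;x_0,t_0)$ denotes the solution of the nonautonomous system $\dot x=f(x,\lambda(rt))$ with $x(t_0;x_0,t_0)=x_0$ (it depends on $r$). Asymptotically constant parameter shift: a continuously differentiable $\lambda:\mathbb R\to\mathbb R$ with $\lambda_-<\lambda(s)<\lambda_+$ for all $s$, $\lim_{s\to\pm\infty}\lambda(s)=\lambda_\pm$ and $\lim_{s\to\pm\infty}d\lambda(s)/ds=0$. Stable path: $(X(s),\lambda(s))$ where $X:\mathbb R\to\mathbb R^N$ is a continuous curve such that, for each fixed $s\in\mathbb R$, $X(s)$ is an attracting hyperbolic equilibrium of the autonomous system $\dot x=f(x,\lambda(s))$. It is a stable path of the augmented autonomous system $\dot x=f(x,\lambda(s))$, $\dot s=r$. The limits $X_\pm=\lim_{s\to\pm\infty}X(s)$ exist and are attracting hyperbolic equilibria of $\dot x=f(x,\lambda_\pm)$ respectively; one then speaks of a stable path from $X_-$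 to $X_+$. $\mathbb B(X_+,\lambda_+)$ denotes the basin of attraction of $X_+$ for $\dot x=f(x,\lambda_+)$. Forward inflowing stable: the stable path $(X(s),\lambda(s))$ from $X_-$ to $X_+$ is forward inflowing stable if for each $s\in\mathbb R$ there is a compact set $K(s)\subset\mathbb R^N$ such that: (1) $X(s)\in\operatorname{Int}K(s)$ for all $s\in\mathbb R$; (2) if $s_1<s_2$ then $K(s_1)\subset K(s_2)$; (3) if $x\in\partial K(s)$ then there exists $t_0>0$ such that $x(t;x,s)\in\operatorname{Int}K(s)$ for all $t\in(s,s+t_0)$, where $x(t;x,s)$ is the solution of the nonautonomous system $\dot x=f(x,\lambda(rt))$ that starts at the point $x$ at time $s$ (required for each rate $r>0$ under consideration, $t_0$ being allowed to depend on $r$); (4) $X_\pm\in\operatorname{Int}K_\pm$, where $K_-=\bigcap_{s\in\mathbb R}K(s)$ and $K_+=\overline{\bigcup_{s\in\mathbb R}K(s)}$; (5) $K_+\subset\mathbb B(X_+,\lambda_+)$ is compact. Locally pullback attracting: a solution $\gamma$ is locally pullback attracting if there is $\delta>0$ such that for every $\xi\in\mathbb R^N$ with $|\xi|<\delta$ and every $t$ in the domain of $\gamma$, $\lim_{s\to-\infty}|x(t;\gamma(s)+\xi,s)-\gamma(t)|=0$. Pullback attractor to $X_-$: the (maximally extended) solution $\gamma_r$ of $\dot x=f(x,\lambda(rt))$, defined for all sufficiently negative $t$, that satisfies $\lim_{t\to-\infty}\gamma_r(t)=X_-$ and is locally pullback attracting; it is known that such a solution exists for each $r>0$ because $X_-$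 is an attracting hyperbolic equilibrium of $\dot x=f(x,\lambda_-)$. (Locally) forward attracting: a solution $\gamma:\mathbb R\to\mathbb R^N$ is forward attracting if there is $\delta>0$ such that for every $\xi\in\mathbb R^N$ with $|\xi|<\delta$ and every $t_0\in\mathbb R$, $x(s;\gamma(t_0)+\xi,t_0)$ exists for all $s\ge t_0$ and $\lim_{s\to\infty}|x(s;\gamma(t_0)+\xi,t_0)-\gamma(s)|=0$. *)

(* Defs.v *)
From HB Require Import structures.
From mathcomp Require Import all_boot all_order all_algebra.
From mathcomp Require Import all_classical all_reals all_analysis.
From mathcomp Require Import complex.
Set Implicit Arguments.
Unset Strict Implicit.
Unset Printing Implicit Defensive.
Import Order.TTheory GRing.Theory Num.Theory.
Import numFieldNormedType.Exports.
Local Open Scope classical_set_scope.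
Local Open Scope ring_scope.

(* R^N is 'rV[R]_N with the library norm (the maximum norm).  Every notion below
   that mentions a norm is unchanged if it is replaced by the Euclidean one. *)

(* Frechet differentiable everywhere, with a derivative that is continuous for
   the operator norm: ||'d f q - 'd f p|| <= e for q close to p. *)
Definition continuously_differentiable (R : realType) (U W : normedModType R)
    (f : U -> W) : Prop :=
  (forall p, differentiable f p) /\
  (forall p (e : R), 0 < e ->
     \forall q \near p, forall v, `|'d f q v - 'd f p v| <= e * `|v|).

Definition boundary (T : topologicalType) (A : set T) : set T :=
  closure A `\` interior A.

Section ODE.
Variables (R : realType) (N : nat).
Implicit Types (F : R -> 'rV[R]_N -> 'rV[R]_N) (D I : set R).
Implicit Types (x : R -> 'rV[R]_N).

(* x solves x' = F t x on the open interval D; its values outside D are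
   irrelevant. *)
Definition solution F D x : Prop :=
  [/\ open D, is_interval D & forall t, D t -> is_derive t 1 x (F t (x t))].

Definition maximal_solution F D x : Prop :=
  solution F D x /\
  forall D' y, solution F D' y -> D `<=` D' ->
    (forall t, D t -> y t = x t) -> D' = D.

(* y is the value at time t of some solution with value x0 at time t0. *)
Definition reaches F (t0 : R) (x0 : 'rV[R]_N) (t : R) (y : 'rV[R]_N) : Prop :=
  exists D x, [/\ solution F D x, D t0, D t, x t0 = x0 & x t = y].

Definition flow_exists F (t0 : R) (x0 : 'rV[R]_N) (t : R) : Prop :=
  exists y, reaches F t0 x0 t y.

(* x(t; x0, t0), meaningful only under [flow_exists F t0 x0 t]. *)
Definition flow F (t0 : R) (x0 : 'rV[R]_N) (t : R) : 'rV[R]_N :=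
  xget 0 [set y | reaches F t0 x0 t y].

Definition locally_pullback_attracting F D (g : R -> 'rV[R]_N) : Prop :=
  exists2 delta : R, 0 < delta &
    forall xi : 'rV[R]_N, `|xi| < delta -> forall t, D t ->
      (\forall s \near -oo, flow_exists F s (g s + xi) t) /\
      `|flow F s (g s + xi) t - g t| @[s --> -oo] --> (0 : R).

Definition forward_attracting F (g : R -> 'rV[R]_N) : Prop :=
  exists2 delta : R, 0 < delta &
    forall xi : 'rV[R]_N, `|xi| < delta -> forall t0 : R,
      (forall s, t0 <= s -> flow_exists F t0 (g t0 + xi) s) /\
      `|flow F t0 (g t0 + xi) s - g s| @[s --> +oo] --> (0 : R).

End ODE.

Section RateInduced.
Variables (R : realType) (N : nat).
Implicit Types (f : 'rV[R]_N * R -> 'rV[R]_N) (lam : R -> R).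
Implicit Types (X : R -> 'rV[R]_N) (Xm Xp : 'rV[R]_N) (lm lp l r : R).

Definition frozen f l : R -> 'rV[R]_N -> 'rV[R]_N := fun _ x => f (x, l).

Definition ramped f lam r : R -> 'rV[R]_N -> 'rV[R]_N :=
  fun t x => f (x, lam (r * t)).

Definition parameter_shift lm lp lam : Prop :=
  [/\ (forall s, derivable lam s 1) /\ continuous (derive1 lam),
      forall s, lm < lam s < lp,
      lam s @[s --> -oo] --> lm /\ lam s @[s --> +oo] --> lp &
      derive1 lam s @[s --> -oo] --> (0 : R) /\
      derive1 lam s @[s --> +oo] --> (0 : R)].

(* An equilibrium at which all complex eigenvalues of the Jacobian matrix of
   f(., l) have negative real part. *)
Definition attracting_hyperbolic_equilibrium f l (x : 'rV[R]_N) : Prop :=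
  f (x, l) = 0 /\
  forall z : R[i],
    eigenvalue (map_mx (real_complex R) (jacobian (fun y => f (y, l)) x)) z ->
    complex.Re z < 0.

Definition stable_path f lam lm lp X Xm Xp : Prop :=
  [/\ continuous X,
      forall s, attracting_hyperbolic_equilibrium f (lam s) (X s),
      X s @[s --> -oo] --> Xm /\ X s @[s --> +oo] --> Xp,
      attracting_hyperbolic_equilibrium f lm Xm &
      attracting_hyperbolic_equilibrium f lp Xp].

Definition basin f l (xeq : 'rV[R]_N) : set 'rV[R]_N :=
  [set x0 | (forall t, 0 <= t -> flow_exists (frozen f l) 0 x0 t) /\
            flow (frozen f l) 0 x0 t @[t --> +oo] --> xeq].

(* The sets K s do not depend on the rate r; the time t0 in the third clause
   does. *)
Definition forward_inflowing_stable f lam lp X Xm Xp : Prop :=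
  exists K : R -> set 'rV[R]_N,
    let Km := \bigcap_s K s in
    let Kp := closure (\bigcup_s K s) in
    (forall s, compact (K s)) /\
    [/\ forall s, interior (K s) (X s),
        forall s1 s2, s1 < s2 -> K s1 `<=` K s2,
        forall r, 0 < r -> forall s x, boundary (K s) x ->
          exists2 t0 : R, 0 < t0 & forall t, s < t < s + t0 ->
            flow_exists (ramped f lam r) s x t /\
            interior (K s) (flow (ramped f lam r) s x t),
        interior Km Xm /\ interior Kp Xp &
        Kp `<=` basin f lp Xp /\ compact Kp].

(* D is the maximal interval of definition of g. *)
Definition pullback_attractor f lam r Xm (D : set R) (g : R -> 'rV[R]_N) : Prop :=
  [/\ maximal_solution (ramped f lam r) D g,
      exists a, `]-oo, a[ `<=` D,
      g t @[t --> -oo] --> Xm &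
      locally_pullback_attracting (ramped f lam r) D g].

Definition endpoint_tracking X r (g : R -> 'rV[R]_N) : Prop :=
  `|g t - X (r * t)| @[t --> +oo] --> (0 : R).

End RateInduced.

(* Main.v *)
Require Import Defs.
From HB Require Import structures.
From mathcomp Require Import all_boot all_order all_algebra.
From mathcomp Require Import all_classical all_reals all_analysis.
From mathcomp Require Import complex spectral ring lra.
Set Implicit Arguments.
Unset Strict Implicit.
Unset Printing Implicit Defensive.
Import Order.TTheory GRing.Theory Num.Theory.
Import numFieldNormedType.Exports.
Local Open Scope classical_set_scope.
Local Open Scope ring_scope.

(* Since the sets K(s) increase with s and the flow enters the interior of K(s)
   from its boundary at time s, a solution with x(t0) in K(t0) satisfies x(t) in
   K(t) for all t >= t0.  The pullback attractor is in every K(s) for early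
   times, because it starts at X_- in Int K_-; hence it is global and stays in
   the compact set K_+, which lies in the basin of X_+ for the limiting equation.
   A cluster point of the solution is moved close to X_+ by the limiting flow,
   and the solution shadows this motion by continuous dependence; it then stays
   near X_+ and converges to it by a quadratic Lyapunov function, built from a
   Schur triangularization of the Jacobian whose off-diagonal part is made small
   by a diagonal scaling.  For forward attraction, a perturbation made early is
   again trapped in K, one made on a compact time interval stays near the
   attractor by Gronwall, and one made late is near X_+.  Existence for perturbed
   data comes from Picard iteration for the field clamped to a large cube. *)

(** * Quadratic Lyapunov functions *)

(** The norm on row vectors is the maximum norm, which is not smooth. Energy estimates therefore use
    this Euclidean product and return to the norm through [norm_sqr_le_dot] and [dot_le_norm]. *)
Definition dot (R : pzRingType) n (u v : 'rV[R]_n) : R := \sum_j u 0 j * v 0 j.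

Section LyapunovForm.
Variable R : rcfType.

Lemma ReD (x y : R[i]) : complex.Re (x + y) = complex.Re x + complex.Re y.
Proof. by case: x y => [? ?] [? ?]. Qed.

Lemma ImD (x y : R[i]) : complex.Im (x + y) = complex.Im x + complex.Im y.
Proof. by case: x y => [? ?] [? ?]. Qed.

Lemma ReM (x y : R[i]) : complex.Re (x * y) =
  complex.Re x * complex.Re y - complex.Im x * complex.Im y.
Proof. by case: x y => [? ?] [? ?]. Qed.

Lemma ImM (x y : R[i]) : complex.Im (x * y) =
  complex.Re x * complex.Im y + complex.Im x * complex.Re y.
Proof. by case: x y => [? ?] [? ?]. Qed.

Lemma Re_sum (I : finType) (F : I -> R[i]) :
  complex.Re (\sum_i F i) = \sum_i complex.Re (F i).
Proof. exact: (big_morph _ ReD). Qed.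

Lemma Im_sum (I : finType) (F : I -> R[i]) :
  complex.Im (\sum_i F i) = \sum_i complex.Im (F i).
Proof. exact: (big_morph _ ImD). Qed.

Local Notation Cmx := (map_mx (real_complex R)).
Local Notation Remx := (map_mx (@complex.Re R)).
Local Notation Immx := (map_mx (@complex.Im R)).

Lemma Remx_mulr m n p (A : 'M[R]_(m, n)) (S : 'M[R[i]]_(n, p)) :
  Remx (Cmx A *m S) = A *m Remx S.
Proof.
apply/matrixP => i j; rewrite !mxE Re_sum; apply: eq_bigr => k _.
by rewrite !mxE ReM /= mul0r subr0.
Qed.

Lemma Immx_mulr m n p (A : 'M[R]_(m, n)) (S : 'M[R[i]]_(n, p)) :
  Immx (Cmx A *m S) = A *m Immx S.
Proof.
apply/matrixP => i j; rewrite !mxE Im_sum; apply: eq_bigr => k _.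
by rewrite !mxE ImM /= mul0r addr0.
Qed.

Lemma Remx_mul m n p (S : 'M[R[i]]_(m, n)) (T : 'M[R[i]]_(n, p)) :
  Remx (S *m T) = Remx S *m Remx T - Immx S *m Immx T.
Proof.
apply/matrixP => i j; rewrite !mxE Re_sum -sumrB; apply: eq_bigr => k _.
by rewrite !mxE ReM.
Qed.

Lemma dot_row_mx m n (a b : 'rV[R]_m) (c d : 'rV[R]_n) :
  dot (row_mx a c) (row_mx b d) = dot a b + dot c d.
Proof.
rewrite /dot big_split_ord /=; congr (_ + _); apply: eq_bigr => j _.
  by rewrite !row_mxEl.
by rewrite !row_mxEr.
Qed.

(* The real scalar product of y and y *m T under the identification of C^n
   with R^2n. *)
Lemma dot_lower_trig n (T : 'M[R[i]]_n) (y : 'rV[R[i]]_n) (al e : R) :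
    0 <= e ->
    (forall j, complex.Re (T j j) <= - al) ->
    (forall i j, i != j -> `|complex.Re (T i j)| <= e /\ `|complex.Im (T i j)| <= e) ->
  dot (Remx y) (Remx (y *m T)) + dot (Immx y) (Immx (y *m T)) <=
  (2 * n%:R * e - al) *
    (dot (Remx y) (Remx y) + dot (Immx y) (Immx y)).
Proof.
move=> e0 hd ho.
pose q j := complex.Re (y 0 j) ^+ 2 + complex.Im (y 0 j) ^+ 2.
have q0 j : 0 <= q j by rewrite addr_ge0 ?sqr_ge0.
have -> : dot (Remx y) (Remx y) + dot (Immx y) (Immx y) = \sum_j q j.
  by rewrite /dot -big_split; apply: eq_bigr => j _; rewrite !mxE /q /= !expr2.
have -> : dot (Remx y) (Remx (y *m T)) + dot (Immx y) (Immx (y *m T)) =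
    \sum_j \sum_i (complex.Re (y 0 j) * complex.Re (y 0 i * T i j) +
                   complex.Im (y 0 j) * complex.Im (y 0 i * T i j)).
  rewrite /dot -big_split; apply: eq_bigr => j _.
  by rewrite !mxE Re_sum Im_sum !mulr_sumr -big_split.
(* Only the diagonal produces decay; an off-diagonal entry costs at most [e * (q i + q j)] by the
   inequality between arithmetic and geometric means. Keeping this nonnegative cost on the diagonal
   too makes the double sum uniform, with total [2 * n%:R * e] times the sum of [q]. *)
have H i j : complex.Re (y 0 j) * complex.Re (y 0 i * T i j) +
    complex.Im (y 0 j) * complex.Im (y 0 i * T i j) <=
    (if i == j then - al * q j else 0) + e * (q i + q j).
  rewrite ReM ImM /q.
  have [->|ij] := eqVneq i j.
    have := hd j; have := q0 j; rewrite /q.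
    move: (complex.Re _) (complex.Im _) (complex.Re _) (complex.Im _) => a b c d.
    move=> q1 h; nra.
  have [hr hi] := ho _ _ ij; rewrite add0r.
  set a := complex.Re (y 0 j); set b := complex.Im (y 0 j).
  set c := complex.Re (y 0 i); set d := complex.Im (y 0 i).
  move: hr hi; set u := complex.Re _; set v := complex.Im _ => hr hi.
  pose s := (c ^+ 2 + d ^+ 2 + (a ^+ 2 + b ^+ 2)) / 2.
  have h1 : `|u * (a * c + b * d)| <= e * s.
    rewrite normrM ler_pM // ler_norml /s.
    have := sqr_ge0 (a - c); have := sqr_ge0 (a + c).
    have := sqr_ge0 (b - d); have := sqr_ge0 (b + d).
    by rewrite !expr2 => *; apply/andP; split; nra.
  have h2 : `|v * (b * c - a * d)| <= e * s.
    rewrite normrM ler_pM // ler_norml /s.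
    have := sqr_ge0 (b - c); have := sqr_ge0 (b + c).
    have := sqr_ge0 (a - d); have := sqr_ge0 (a + d).
    by rewrite !expr2 => *; apply/andP; split; nra.
  have -> : e * (c ^+ 2 + d ^+ 2 + (a ^+ 2 + b ^+ 2)) = e * s + e * s.
    by rewrite /s; lra.
  have -> : a * (c * u - d * v) + b * (c * v + d * u) =
    u * (a * c + b * d) + v * (b * c - a * d) by ring.
  by apply: lerD; [exact: le_trans (ler_norm _) h1|exact: le_trans (ler_norm _) h2].
apply: le_trans (ler_sum _ (fun j _ => ler_sum _ (fun i _ => H i j))) _.
under eq_bigr => j _ do rewrite big_split /= -big_mkcond big_pred1_eq -mulr_sumr.
rewrite big_split /= -mulr_sumr -mulr_sumr.
have -> : \sum_j \sum_i (q i + q j) = 2 * n%:R * \sum_j q j.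
  under eq_bigr => j _ do rewrite big_split /= sumr_const card_ord.
  rewrite big_split /= sumr_const card_ord sumrMnl -mulr2n.
  by rewrite -[X in X *+ 2]mulr_natl -[LHS]mulr_natl mulrA.
lra.
Qed.

Lemma eigenvalue_similar (F : fieldType) n (P A T : 'M[F]_n) a :
  P \in unitmx -> P *m A = T *m P -> eigenvalue T a -> eigenvalue A a.
Proof.
move=> Pu PA /eigenvalueP[v vE v0]; apply/eigenvalueP; exists (v *m P).
  by rewrite scalemxAl -vE -!mulmxA PA.
apply: contraNneq v0 => vP0.
by rewrite -(mulmxK Pu v) vP0 mul0mx.
Qed.

Lemma eigenvalue_trig_diag (F : fieldType) n (T : 'M[F]_n) j :
  is_trig_mx T -> eigenvalue T (T j j).
Proof.
move=> Tt; rewrite eigenvalue_root_char char_poly_trig // (bigD1 j) //=.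
by rewrite rootM root_XsubC eqxx.
Qed.

(** A complex change of basis [S] turns [A] into a triangular matrix [T'] whose off-diagonal part is
    negligible against the real parts of its diagonal. Splitting [S] into real and imaginary parts
    gives a real [Q] with twice as many columns, and [dot (x *m Q) (x *m Q)] is then a strict
    Lyapunov function of the linear system. The one-sided inverse [Q'] makes this form positive
    definite. *)
Lemma lyapunov_form n (A : 'M[R]_n) :
    (forall z : R[i], eigenvalue (Cmx A) z -> complex.Re z < 0) ->
  exists m (Q : 'M[R]_(n, m)) (Q' : 'M[R]_(m, n)) (al : R),
    [/\ 0 < al, Q *m Q' = 1%:M &
        forall x : 'rV_n, dot (x *m Q) (x *m A *m Q) <=
                          - al * dot (x *m Q) (x *m Q)].
Proof.
(* Dimension zero is treated apart, since [Schur] is applied with a proof that the dimension is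
   positive. *)
case: n A => [|n] A hA.
  exists 0%N, 0, 0, 1; split => // [|x]; first by apply/matrixP => -[].
  by rewrite /dot !big_ord0 mulr0.
have [P Pu [T PA Tt]] : exists2 P : 'M[R[i]]_n.+1, P \in unitmx &
    exists2 T, P *m Cmx A = T *m P & is_trig_mx T.
  have [P Pun] := Schur (Cmx A) (ltn0Sn n).
  have Pu := unitarymx_unit Pun.
  rewrite /similar_to /= conjumx // => Tt; exists P => //.
  by exists (P *m Cmx A *m invmx P); rewrite ?mulmxKV.
have hT j : complex.Re (T j j) < 0.
  by apply: hA; apply: eigenvalue_similar Pu PA _; exact: eigenvalue_trig_diag.
have [al al0 hal] : exists2 al : R, 0 < al & forall j, complex.Re (T j j) <= - al.
  pose m := \big[Num.min/1]_j (- complex.Re (T j j)).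
  exists m; first by apply/bigmin_gtP; split=> // j _; rewrite oppr_gt0.
  by move=> j; rewrite lerNr; apply: bigmin_le_cond.
have [B B0 hB] : exists2 B : R, 0 < B &
    forall i j, `|complex.Re (T i j)| <= B /\ `|complex.Im (T i j)| <= B.
  exists (1 + \sum_i \sum_j (`|complex.Re (T i j)| + `|complex.Im (T i j)|)).
    by rewrite ltr_wpDr // sumr_ge0 // => i _; rewrite sumr_ge0 // => j _; rewrite addr_ge0.
  have S0 i j : 0 <= `|complex.Re (T i j)| + `|complex.Im (T i j)| by rewrite addr_ge0.
  move=> i j; suff : `|complex.Re (T i j)| + `|complex.Im (T i j)| <=
      1 + \sum_i \sum_j (`|complex.Re (T i j)| + `|complex.Im (T i j)|).
    move=> h; split; apply: le_trans h; first by rewrite lerDl.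
    by rewrite lerDr.
  rewrite (bigD1 i) //= (bigD1 j) //=.
  apply: ler_wpDl => //; rewrite -(addrA (_ + _)) lerDl addr_ge0 ?sumr_ge0 // => k _.
  by rewrite sumr_ge0.
pose N1 : R := n.+1%:R.
have N10 : 0 < N1 by rewrite ltr0n.
(* With this value the off-diagonal cost [2 * N1 * e] equals [al / 2], so half of the decay rate
   survives. *)
pose e := al / (4 * N1).
have e0 : 0 < e by rewrite divr_gt0 // mulr_gt0.
(* Conjugation by the diagonal matrix of powers of [K] multiplies an entry below the diagonal by at
   most [K^-1], and [B / K <= e]. *)
pose K := 1 + B / e.
have K1 : 1 <= K by rewrite /K lerDl divr_ge0 // ltW.
have K0 : 0 < K by apply: lt_le_trans K1.
pose k (j : 'I_n.+1) : R[i] := real_complex R (K ^+ j).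
pose S : 'M[R[i]]_n.+1 := invmx P *m diag_mx (\row_j k j).
pose S' : 'M[R[i]]_n.+1 := diag_mx (\row_j (real_complex R (K ^- j))) *m P.
have SS' : S *m S' = 1%:M.
  rewrite /S /S' mulmxA -(mulmxA (invmx P)) mulmx_diag.
  rewrite (_ : \row_j _ = const_mx 1) ?diag_const_mx ?mulmx1 ?mulVmx //.
  apply/rowP => j; rewrite !mxE /k -rmorphM /= divff ?rmorph1 //.
  by rewrite expf_neq0 // gt_eqF.
pose T' : 'M[R[i]]_n.+1 := \matrix_(i, j) (real_complex R (K ^+ j / K ^+ i) * T i j).
have AS : Cmx A *m S = S *m T'.
  have -> : Cmx A *m S = invmx P *m (T *m diag_mx (\row_j k j)).
    have -> : Cmx A = invmx P *m (T *m P) by rewrite -PA mulKmx.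
    by rewrite /S !mulmxA mulmxK.
  rewrite /S -(mulmxA (invmx P)); congr (invmx P *m _); apply/matrixP => i j.
  rewrite mul_mx_diag mul_diag_mx !mxE /k mulrA -rmorphM mulrCA divff ?mulr1 1?mulrC //.
  by rewrite expf_neq0 // gt_eqF.
have hT'o i j : i != j -> `|complex.Re (T' i j)| <= e /\ `|complex.Im (T' i j)| <= e.
  rewrite !mxE ReM ImM /= !mul0r subr0 addr0 neq_lt.
  case/orP => [ij|ji].
    by have /is_trig_mxP -> // := Tt; rewrite /= !mulr0 normr0 ltW.
  have h : `|K ^+ j / K ^+ i| <= e / B.
    rewrite ger0_norm ?divr_ge0 ?exprn_ge0 ?(ltW K0) //.
    have eB : 0 < e / B by apply: divr_gt0.
    rewrite ler_pdivrMr ?exprn_gt0 // -ler_pdivrMl // invf_div.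
    apply: (@le_trans _ _ (K ^+ j.+1)); last by rewrite ler_weXn2l.
    by rewrite exprS ler_wpM2r ?exprn_ge0 ?(ltW K0) // /K lerDr.
  have [h1 h2] := hB i j.
  by split; rewrite normrM -[leRHS](divfK (lt0r_neq0 B0)) ler_pM.
have hT'd j : complex.Re (T' j j) <= - al.
  rewrite mxE divff ?rmorph1 ?mul1r //.
  by rewrite expf_neq0 // gt_eqF.
(* The product of these two real block matrices is the real part of [S *m S'], which is the
   identity. *)
exists (n.+1 + n.+1)%N, (row_mx (Remx S) (Immx S)), (col_mx (Remx S') (- Immx S')), (al / 2).
split; first by rewrite divr_gt0.
  rewrite mul_row_col mulmxN -Remx_mul SS'.
  by apply/matrixP => i j; rewrite !mxE; case: eqP.
move=> x; rewrite !mul_mx_row !dot_row_mx -!Remx_mulr -!Immx_mulr.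
rewrite map_mxM -!mulmxA AS !mulmxA.
apply: le_trans (dot_lower_trig _ (ltW e0) hT'd hT'o) _.
rewrite -/N1 (_ : 2 * N1 * e = al / 2); last first.
  by rewrite /e; field; rewrite gt_eqF.
rewrite ler_wpM2r; [by []| |lra].
by rewrite addr_ge0 // sumr_ge0 // => j _; rewrite -expr2 sqr_ge0.
Qed.

End LyapunovForm.

(** * Differential inequalities *)

Section Calculus.
Variable R : realType.

Lemma is_derive_coord n (z : R -> 'rV[R]_n) (t : R) (v : 'rV[R]_n) i :
  is_derive t 1 z v -> is_derive t 1 (fun s => z s 0 i) (v 0 i).
Proof.
move=> dz; have dz1 : derivable z t 1 by [].
have := derive_mx dz1; rewrite derive_val => ->; rewrite mxE.
by apply: derivableP; apply: (derivable_mxP z t 1).1.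
Qed.

Lemma is_derive_rV n (z : R -> 'rV[R]_n) (t : R) (v : 'rV[R]_n) :
  (forall i, is_derive t 1 (fun s => z s 0 i) (v 0 i)) -> is_derive t 1 z v.
Proof.
move=> dz; have dz1 : derivable z t 1.
  by apply/derivable_mxP => i j; rewrite (ord1 i).
apply: DeriveDef => //; rewrite (derive_mx dz1).
by apply/rowP => i; rewrite mxE; apply: derive_val.
Qed.

Lemma is_derive_sumfun n (h : 'I_n -> R -> R) (t : R) (dh : 'I_n -> R) :
  (forall i, is_derive t 1 (h i) (dh i)) ->
  is_derive t 1 (fun s => \sum_i h i s) (\sum_i dh i).
Proof.
move=> H; rewrite (_ : (fun s => _) = \sum_i h i); first exact: is_derive_sum.
by apply/funext => s; rewrite fct_sumE.
Qed.

Lemma is_derive_mulmxr m n (Q : 'M[R]_(m, n)) (z : R -> 'rV[R]_m) (t : R) (v : 'rV[R]_m) :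
  is_derive t 1 z v -> is_derive t 1 (fun s => z s *m Q) (v *m Q).
Proof.
move=> dz; apply: is_derive_rV => j.
rewrite (_ : (fun s => _) = fun s => \sum_i z s 0 i * Q i j); last first.
  by apply/funext => s; rewrite mxE.
rewrite mxE; apply: is_derive_sumfun => i.
have -> : (fun s => z s 0 i * Q i j) = Q i j \*: (fun s => z s 0 i).
  by apply/funext => s; rewrite /= mulrC.
have dzi := is_derive_coord i dz.
by apply: is_derive_eq; rewrite /GRing.scale /= mulrC.
Qed.

Lemma is_derive_dot n (z : R -> 'rV[R]_n) (t : R) (v : 'rV[R]_n) :
  is_derive t 1 z v ->
  is_derive t 1 (fun s => dot (z s) (z s)) (2 * dot (z t) v).
Proof.
move=> dz; rewrite /dot mulr_sumr; apply: is_derive_sumfun => i.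
have dzi := is_derive_coord i dz.
have := is_deriveM dzi dzi.
move=> h; apply: (is_derive_eq h); rewrite /GRing.scale /=; lra.
Qed.

Lemma derive_le0_nincr (g dg : R -> R) (a b : R) : a <= b ->
  (forall t, a <= t <= b -> is_derive t 1 g (dg t)) ->
  (forall t, a <= t <= b -> dg t <= 0) -> g b <= g a.
Proof.
move=> ab dgg dg0.
have in_oo t : t \in `]a, b[ -> a <= t <= b.
  by rewrite in_itv /= => /andP[/ltW -> /ltW ->].
apply: (@ler0_derive1_nincr _ g a b) => //.
- by move=> t /in_oo tab; have := dgg _ tab => -[].
- move=> t /in_oo tab; rewrite derive1E.
  by have -> := @derive_val _ _ _ _ _ _ _ (dgg _ tab); exact: dg0.
- apply: derivable_within_continuous => t; rewrite in_itv /= => tab.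
  by have := dgg _ tab => -[].
Qed.

Lemma derive_le (g h dg dh : R -> R) (a b : R) : a <= b ->
  (forall t, a <= t <= b -> is_derive t 1 g (dg t)) ->
  (forall t, a <= t <= b -> is_derive t 1 h (dh t)) ->
  (forall t, a <= t <= b -> dg t <= dh t) -> g b - g a <= h b - h a.
Proof.
move=> ab dgg dhh le.
have d t : a <= t <= b -> is_derive t 1 (fun t => g t - h t) (dg t - dh t).
  move=> tab; have dg' := dgg _ tab; have dh' := dhh _ tab.
  exact: (is_deriveB dg' dh').
have := derive_le0_nincr ab d.
have d0 t : a <= t <= b -> dg t - dh t <= 0 by move=> tab; rewrite subr_le0 le.
by move=> /(_ d0); lra.
Qed.

(** The function [g t * expR (- k * t)] is nonincreasing. The sign of [k] is free: a positive [k]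
    bounds growth, a negative one gives exponential decay. *)
Lemma gronwall (g dg : R -> R) (k a b : R) : a <= b ->
  (forall t, a <= t <= b -> is_derive t 1 g (dg t)) ->
  (forall t, a <= t <= b -> dg t <= k * g t) -> g b <= g a * expR (k * (b - a)).
Proof.
move=> ab dgg le.
pose h := fun t => g t * expR (- k * t).
have dh t : a <= t <= b -> is_derive t 1 h ((dg t - k * g t) * expR (- k * t)).
  move=> tab; have := dgg _ tab => dgt; rewrite /h.
  have de : is_derive t 1 (fun t => expR (- k * t)) (- k * expR (- k * t)).
    have dl : is_derive t 1 (fun t => - k * t) (- k).
      have h' := is_deriveZ (- k) (is_derive_id t (1 : R)).
      by apply: (is_derive_eq h'); rewrite /GRing.scale /= mulr1.
    have := @is_derive1_comp _ (@expR R) (fun t => - k * t) t _ _ (is_derive_expR _) dl.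
    by move=> h'; apply: (is_derive_eq h'); rewrite mulrC.
  have := is_deriveM dgt de.
  by move=> h1; apply: (is_derive_eq h1); rewrite /GRing.scale /=; lra.
have := derive_le0_nincr ab dh.
have h0 t : a <= t <= b -> (dg t - k * g t) * expR (- k * t) <= 0.
  by move=> tab; rewrite mulr_le0_ge0 ?expR_ge0 // subr_le0 le.
move=> /(_ h0) hh.
have : h b * expR (k * b) <= h a * expR (k * b) by rewrite ler_wpM2r ?expR_ge0.
rewrite /h -!mulrA -!expRD.
have -> : - k * b + k * b = 0 by ring.
have -> : - k * a + k * b = k * (b - a) by ring.
by rewrite expR0 mulr1.
Qed.

End Calculus.

(** * Comparison of the maximum norm with the Euclidean product *)

Section NormDot.
Variables (R : realType) (n : nat).
Implicit Types u v : 'rV[R]_n.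

Lemma coord_le_norm u i : `|u 0 i| <= `|u|.
Proof.
rewrite [leRHS]/Num.Def.normr /= mx_normrE.
exact: (le_bigmax _ (fun ij : 'I_1 * 'I_n => `|u ij.1 ij.2|) (0, i)).
Qed.

Lemma norm_le_coord u c : 0 <= c -> (forall i, `|u 0 i| <= c) -> `|u| <= c.
Proof.
move=> c0 H; rewrite [leLHS]/Num.Def.normr /= mx_normrE.
by apply: bigmax_le => // -[i j] _; rewrite /= (ord1 i).
Qed.

Lemma dot_ge0 u : 0 <= dot u u.
Proof. by rewrite sumr_ge0 // => j _; rewrite -expr2 sqr_ge0. Qed.

Lemma norm_sqr_le_dot u : `|u| ^+ 2 <= dot u u.
Proof.
rewrite -(sqr_sqrtr (dot_ge0 u)) lerXn2r ?nnegrE ?sqrtr_ge0 //.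
apply: norm_le_coord => [|i]; first exact: sqrtr_ge0.
rewrite -sqrtr_sqr ler_wsqrtr // /dot (bigD1 i) //= expr2 lerDl.
by rewrite sumr_ge0 // => j _; rewrite -expr2 sqr_ge0.
Qed.

Lemma dot_le_norm u v : dot u v <= n%:R * (`|u| * `|v|).
Proof.
rewrite /dot -[n in n%:R]card_ord -sumr_const mulr_suml ler_sum // => i _.
by rewrite mul1r (le_trans (ler_norm _)) // normrM ler_pM ?coord_le_norm.
Qed.

(** Gronwall's inequality is applied to [dot (u t) (u t) + e ^+ 2]: the added square absorbs the
    constant forcing through [2 * |u| * e <= |u|^2 + e^2], and the factor [n] is the price of
    [dot_le_norm]. *)
Lemma gronwall_rV (u du : R -> 'rV[R]_n) (L e a b : R) :
  0 <= L -> 0 <= e -> a <= b ->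
  (forall t, a <= t <= b -> is_derive t 1 u (du t)) ->
  (forall t, a <= t <= b -> `|du t| <= L * `|u t| + e) ->
  dot (u b) (u b) <= (dot (u a) (u a) + e ^+ 2) *
                     expR (n%:R * (2 * L + 1) * (b - a)).
Proof.
move=> L0 e0 ab duu le.
set k := n%:R * (2 * L + 1).
pose g t := dot (u t) (u t) + e ^+ 2.
have dg t : a <= t <= b -> is_derive t 1 g (2 * dot (u t) (du t)).
  move=> tab; have := is_derive_dot (duu _ tab) => h.
  have h' := is_deriveD h (is_derive_cst (e ^+ 2) t 1).
  by apply: (is_derive_eq h'); rewrite addr0.
apply: (@le_trans _ _ (g b)); first by rewrite lerDl sqr_ge0.
apply: (gronwall ab dg) => t tab.
have h1 := dot_le_norm (u t) (du t).
have h2 := le t tab.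
have h3 : n%:R * (`|u t| * `|du t|) <= n%:R * (`|u t| * (L * `|u t| + e)).
  by rewrite ler_wpM2l // ler_wpM2l.
have h4 : `|u t| * (L * `|u t| + e) * 2 <= (2 * L + 1) * g t.
  have := norm_sqr_le_dot (u t); rewrite /g.
  have := sqr_ge0 (`|u t| - e); have := normr_ge0 (u t).
  move: `|u t| (dot _ _) => x d; rewrite !expr2; nra.
rewrite mulrC; apply: (@le_trans _ _ (n%:R * (`|u t| * (L * `|u t| + e) * 2))).
  by rewrite mulrA ler_wpM2r // (le_trans h1 h3).
by rewrite /k -[leRHS]mulrA ler_wpM2l.
Qed.

Lemma closed_ball_compact (M : R) : compact [set x : 'rV[R]_n | `|x| <= M].
Proof.
apply: bounded_closed_compact.
  exists M; split; first exact: num_real.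
  by move=> y My x /= /le_trans -> //; exact: ltW.
rewrite (_ : [set x | _] = (fun x : 'rV[R]_n => `|x|) @^-1` [set t | t <= M]) //.
by apply: preimage_closed; [move=> ? _; exact: norm_continuous | exact: closed_le].
Qed.

End NormDot.

(** * Lipschitz bounds for a continuously differentiable map on balls *)

Section LipschitzBall.
Variables (R : realType) (n m : nat) (f : 'rV[R]_n * R -> 'rV[R]_m).
Hypothesis hf : continuously_differentiable f.

Lemma is_derive_line (p v : 'rV[R]_n * R) (s : R) :
  is_derive s 1 (fun s => f (p + s *: v)) ('d f (p + s *: v) v).
Proof.
have df := hf.1 (p + s *: v).
have h : is_derive (p + s *: v) v f ('d f (p + s *: v) v).
  by rewrite -deriveE //; apply/derivableP/diff_derivable.
have E : (fun h : R => h^-1 *: (((fun s => f (p + s *: v)) \o shift s) (h *: (1 : R))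
             - f (p + s *: v))) =
         (fun h : R => h^-1 *: ((f \o shift (p + s *: v)) (h *: v) - f (p + s *: v))).
  apply/funext => h0 /=; congr (_ *: (f _ - _)).
  by rewrite [h0 *: 1]mulr1 scalerDl addrCA.
case: h => h1 h2; split; first by rewrite /derivable E.
by rewrite -h2 /derive E.
Qed.

(** Near each point the derivative differs from its value there by at most one in operator norm, so
    every large [C] is a bound nearby; compactness of the ball times the segment makes one [C] serve
    everywhere. *)
Lemma derivative_bounded (M : R) : exists2 C, 0 <= C &
  forall p, `|p.1| <= M -> `|p.2| <= M -> forall v, `|'d f p v| <= C * `|v|.
Proof.
have cK : compact ([set x : 'rV[R]_n | `|x| <= M] `*` `[- M, M]%classic).
  by apply: compact_setX; [exact: closed_ball_compact|exact: segment_compact].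
have := (compact_near_coveringP _).1 cK R +oo_R
  (fun C q => forall v, `|'d f q v| <= C * `|v|) _.
case.
  move=> p _.
  have : \forall C \near +oo_R, forall v, `|'d f p v| <= C * `|v|.
    apply/linear_boundedP/linear_bounded_continuous.
    exact: diff_continuous (hf.1 p).
  move=> [C0 [_ hC]].
  exists ([set q | forall v, `|'d f q v - 'd f p v| <= 1 * `|v|], [set C | C0 + 1 < C]).
    split; first exact: (hf.2 p 1 ltr01).
    by apply: nbhs_pinfty_gt; exact: num_real.
  move=> [q C] [/= hq hC'] v.
  rewrite -[X in `|X|](subrK ('d f p v)) (le_trans (ler_normD _ _)) //.
  have -> : C = 1 + (C - 1) by rewrite addrC subrK.
  rewrite mulrDl lerD //.
  by apply: hC; rewrite ltrBrDr.
move=> C0 [C0r hC]; exists (Num.max (C0 + 1) 0); first by rewrite le_max lexx orbT.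
move=> p p1 p2 v.
apply: (hC (Num.max (C0 + 1) 0)).
  by rewrite lt_max ltrDl ltr01.
by split => //=; rewrite in_itv /= -ler_norml.
Qed.

(** Mean value inequality along the segment from [(y, k)] to [(x, l)], which stays in the convex set
    where the derivative is bounded. It is applied to each coordinate, as suits the maximum norm. *)
Lemma lipschitz_ball (M : R) : exists2 L, 0 <= L &
  forall x y l k, `|x| <= M -> `|y| <= M -> `|l| <= M -> `|k| <= M ->
    `|f (x, l) - f (y, k)| <= L * Num.max `|x - y| `|l - k|.
Proof.
have [C C0 hC] := derivative_bounded M; exists C => // x y l k xM yM lM kM.
pose p : 'rV[R]_n * R := (y, k); pose v : 'rV[R]_n * R := (x, l) - p.
have -> : Num.max `|x - y| `|l - k| = `|v| by rewrite prod_normE.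
have seg (t : R) : 0 <= t <= 1 -> `|(p + t *: v).1| <= M /\ `|(p + t *: v).2| <= M.
  move=> /andP[t0 t1].
  have conv (V : normedModType R) (a b : V) : `|a| <= M -> `|b| <= M ->
      `|b + t *: (a - b)| <= M.
    move=> aM bM; rewrite scalerBr addrCA -[b in _ + (b - _)]scale1r -scalerBl.
    rewrite (le_trans (ler_normD _ _)) // !normrZ (ger0_norm t0) ger0_norm ?subr_ge0 //.
    have -> : M = t * M + (1 - t) * M by ring.
    by rewrite lerD // ler_wpM2l // subr_ge0.
  by split; apply: conv.
have bnd i t : 0 <= t <= 1 -> `|('d f (p + t *: v) v) 0 i| <= C * `|v|.
  move=> /seg[h1 h2]; exact: le_trans (coord_le_norm _ _) (hC _ h1 h2 v).
apply: norm_le_coord => [|i]; first by rewrite mulr_ge0.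
have dline (t : R) : is_derive t (1 : R) (fun s : R => f (p + s *: v) 0 i)
    (('d f (p + t *: v) v) 0 i).
  exact: is_derive_coord (is_derive_line p v t).
have dlin (c t : R) : is_derive t 1 (fun s : R => s * c) c.
  have h := is_deriveZ c (is_derive_id t (1 : R)).
  rewrite (_ : (fun s => _) = c \*: id); last by apply/funext => s; rewrite /= mulrC.
  by apply: (is_derive_eq h); rewrite /GRing.scale /= mulr1.
have E : (f (x, l) - f (y, k)) 0 i = f (p + 1 *: v) 0 i - f (p + 0 *: v) 0 i.
  by rewrite !mxE scale1r scale0r addr0 (_ : p + v = (x, l)) // /v addrC subrK.
rewrite E ler_norml; apply/andP; split.
  have := @derive_le R (fun s => s * - (C * `|v|)) _ (fun _ => - (C * `|v|)) _ 0 1 ler01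
    (fun t _ => dlin _ t) (fun t _ => dline t).
  by rewrite mul1r mul0r subr0; apply=> t /(bnd i); rewrite ler_norml => /andP[].
have := @derive_le R _ (fun s => s * (C * `|v|)) _ (fun _ => C * `|v|) 0 1 ler01
    (fun t _ => dline t) (fun t _ => dlin _ t).
by rewrite mul1r mul0r subr0; apply=> t /(bnd i); rewrite ler_norml => /andP[].
Qed.

End LipschitzBall.

(** * Global existence *)

Section Antiderivative.
Variable R : realType.

Lemma antiderivative_right (h : R -> R) (a : R) : continuous h ->
  exists H, forall t : R, a < t -> is_derive t (1 : R) H (h t).
Proof.
move=> ch; suff [F dF] : exists F : R -> R, forall t, a < t ->
    derivable F t 1 /\ derive1 F t = h t.
  by exists F => t /dF[d1 d2]; split => //; rewrite -derive1E.
exists (fun x => \int[lebesgue_measure]_(t in `[a, x]) h t)%R => t at_.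
 apply: (@continuous_FTC1 R h (BLeft a) t (t + 1) _ _ _ _).
- by rewrite ltrDl.
- apply: continuous_compact_integrable; first exact: segment_compact.
  exact: continuous_subspaceT.
- by rewrite /= lte_fin.
- exact: ch.
Qed.

(** The integral from [-1] is an antiderivative only to the right of [-1]; reflecting time yields
    another one to the left of [1]. On the overlap they differ by a constant, so after normalization
    at [0] they can be glued there. *)
Lemma antiderivative (h : R -> R) : continuous h ->
  exists H, forall t : R, is_derive t (1 : R) H (h t).
Proof.
move=> ch.
have [A dA] := antiderivative_right (-1) ch.
have ch' : continuous (fun t => h (- t)).
  by move=> t; apply: continuous_comp; [exact: opp_continuous|exact: ch].
have [B0 dB0] := antiderivative_right (-1) ch'.
pose B t := - B0 (- t).
have dB (t : R) : t < 1 -> is_derive t (1 : R) B (h t).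
  move=> t1; have dB0t : is_derive (- t) (1 : R) B0 (h t).
    by rewrite -{2}[t]opprK; apply: dB0; rewrite ltrN2.
  have dN : is_derive t (1 : R) (fun s : R => - s) (- 1).
    exact: is_deriveN (is_derive_id t (1 : R)).
  have d1 := is_deriveN (@is_derive1_comp _ B0 (fun s => - s) t _ _ dB0t dN).
  by apply: (is_derive_eq d1); rewrite mulrN1 opprK.
have AB (t : R) : -1 < t < 1 -> A t - A 0 = B t - B 0.
  have key (a b : R) : -1 < a -> a <= b -> b < 1 -> A b - A a = B b - B a.
    move=> a1 ab b1; apply/eqP; rewrite eq_le.
    have hA s : a <= s <= b -> is_derive s (1 : R) A (h s).
      by move=> /andP[as_ _]; apply: dA; exact: lt_le_trans as_.
    have hB s : a <= s <= b -> is_derive s (1 : R) B (h s).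
      by move=> /andP[_ sb]; apply: dB; exact: le_lt_trans b1.
    by rewrite (derive_le ab hA hB) // (derive_le ab hB hA).
  move=> /andP[t1 t2]; have [t0|t0] := leP 0 t; first exact: key.
  by rewrite -opprB -[RHS]opprB (key t 0) // ltW.
exists (fun t => if t < 0 then B t - B 0 else A t - A 0) => t.
have dshift (G : R -> R) c : is_derive t (1 : R) G (h t) ->
    is_derive t (1 : R) (fun s => G s - c) (h t).
  move=> dG; have d1 := is_deriveB dG (is_derive_cst c t (1 : R)).
  by apply: (is_derive_eq d1); rewrite subr0.
have [t0|t0] := ltP t 0.
  apply: near_eq_is_derive (dshift _ (B 0) (dB t _)); last exact: lt_trans t0 _.
  by near=> s; rewrite ifT //; near: s; exact: lt_nbhsl.
apply: near_eq_is_derive (dshift _ (A 0) (dA t _)); last first.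
  by rewrite (lt_le_trans _ t0) // ltrN10.
have [t1|t1] := ltP t 1; last first.
  near=> s; rewrite ifF //; apply/negbTE; rewrite -leNgt ltW //; near: s.
  by apply: lt_nbhsr; exact: lt_le_trans t1.
near=> s; case: ifPn => // s0; apply: AB; apply/andP; split; near: s.
  by apply: lt_nbhsr; rewrite (lt_le_trans _ t0) // ltrN10.
exact: lt_nbhsl.
Unshelve. all: by end_near. Qed.

Lemma antiderivative_rV n (h : R -> 'rV[R]_n) (t0 : R) (x0 : 'rV[R]_n) :
  continuous h ->
  exists2 H : R -> 'rV[R]_n, H t0 = x0 &
    forall t : R, is_derive t (1 : R) H (h t).
Proof.
move=> ch.
have chi i : exists H : R -> R, H t0 = x0 0 i /\
    forall t : R, is_derive t (1 : R) H (h t 0 i).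
  have [|H dH] := @antiderivative (fun t => h t 0 i).
    move=> t; apply: (@continuous_comp _ _ _ h (fun x : 'rV[R]_n => x 0 i)).
      exact: ch.
    exact: coord_continuous.
  exists (fun t => H t + (x0 0 i - H t0)); split; first by rewrite addrC subrK.
  move=> t; have d1 := is_deriveD (dH t) (is_derive_cst (x0 0 i - H t0) t (1 : R)).
  by apply: (is_derive_eq d1); rewrite addr0.
have [H hH] := choice chi.
exists (fun t => \row_i H i t).
  by apply/rowP => i; rewrite mxE; case: (hH i).
move=> t; apply: is_derive_rV => i.
rewrite (_ : (fun s => _) = H i); first by case: (hH i).
by apply/funext => s; rewrite mxE.
Qed.

End Antiderivative.

Section Geometric.
Variables (R : realType).

Lemma le_geometric (a b K : R) :
  (forall k : nat, a <= b + K * 2^-1 ^+ k) -> a <= b.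
Proof.
move=> H.
have c1 : b + K * 2^-1 ^+ k @[k --> \oo] --> b + K * 0.
  apply: cvgD; first exact: cvg_cst.
  apply: cvgMr; apply: cvg_expr.
  by rewrite ger0_norm ?invr_ge0 // invf_lt1 // ltr1n.
rewrite mulr0 addr0 in c1.
apply: (@ler_cvg_to _ _ _ _ (fun _ : nat => a) _ _ _ (cvg_cst a) c1).
exact: nearW.
Qed.

Lemma geometric_limit n (u : nat -> 'rV[R]_n) (K : R) : 0 <= K ->
  (forall k, `|u k.+1 - u k| <= K * 2^-1 ^+ k) ->
  exists l, forall k, `|u k - l| <= 2 * K * 2^-1 ^+ k.
Proof.
move=> K0 H.
have tail k m : `|u (k + m)%N - u k| <= 2 * K * 2^-1 ^+ k * (1 - 2^-1 ^+ m).
  elim: m => [|m' IH]; first by rewrite addn0 !subrr normr0 mulr0.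
  rewrite addnS -(subrKA (u (k + m')%N)) (le_trans (ler_normD _ _)) //.
  apply: le_trans (lerD (H _) IH) _.
  rewrite exprD exprS le_eqVlt; apply/orP; left; apply/eqP; by field.
have p01 m : 0 <= 1 - 2^-1 ^+ m :> R.
  by rewrite subr_ge0 exprn_ile1 // ?invr_ge0 // invf_le1 // ler1n.
have half0 m : 0 <= 2^-1 ^+ m :> R by rewrite exprn_ge0 // invr_ge0.
have tail' k m : (k <= m)%N -> `|u m - u k| <= 2 * K * 2^-1 ^+ k.
  move=> km; rewrite -(subnKC km); apply: le_trans (tail _ _) _.
  rewrite ler_piMr ?gerBl ?mulr_ge0 // ?mulr_ge0 ?exprn_ge0 ?invr_ge0 //.
have cu : cvg (u @ \oo).
  apply: cauchy_cvg; apply: cauchy_exP => e e0.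
  have [k hk] : exists k, 2 * K * 2^-1 ^+ k < e.
    apply: contrapT => /forallNP hk.
    have : e <= 0.
      apply: (@le_geometric _ _ (2 * K)) => k; rewrite add0r.
      by have /negP := hk k; rewrite -leNgt.
    by rewrite leNgt e0.
  exists (u k); exists k => // m /= km.
  by rewrite -ball_normE /= distrC; apply: le_lt_trans (tail' _ _ km) hk.
exists (lim (u @ \oo)) => k.
have c1 : `|u m - u k| @[m --> \oo] --> `|lim (u @ \oo) - u k|.
  by apply: cvg_norm; apply: cvgB => //; exact: cvg_cst.
rewrite distrC.
apply: (@ler_cvg_to _ _ _ _ _ _ _ _ c1 (cvg_cst (2 * K * 2^-1 ^+ k))).
by exists k => // m /= km; exact: tail'.
Qed.

End Geometric.

(** * Picard iteration for bounded, globally Lipschitz fields *)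

Section Picard.
Variables (R : realType) (n : nat) (F : R -> 'rV[R]_n -> 'rV[R]_n).
Variables (B L : R).
Hypotheses (L0 : 0 < L)
  (Fc : forall x : R -> 'rV[R]_n, continuous x -> continuous (fun t => F t (x t)))
  (Fb : forall t x, `|F t x| <= B)
  (FL : forall t x y, `|F t x - F t y| <= L * `|x - y|).
Variables (t0 : R) (x0 : 'rV[R]_n).

(** A Bielecki weight, twice the hyperbolic cosine of [2 * L * (t - t0)]. In the supremum norm
    weighted by it the Picard operator contracts by one half on the whole line, so no continuation
    from short intervals is needed. [W] is [2 * L] times its antiderivative vanishing at [t0]. *)
Let w (t : R) : R := expR (2 * L * (t - t0)) + expR (- (2 * L) * (t - t0)).
Let W (t : R) : R := expR (2 * L * (t - t0)) - expR (- (2 * L) * (t - t0)).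

Let is_derive_exp (k t : R) :
  is_derive t (1 : R) (fun t => expR (k * (t - t0))) (k * expR (k * (t - t0))).
Proof.
have dl : is_derive t (1 : R) (fun t => k * (t - t0)) k.
  have h := is_deriveZ k (is_deriveB (is_derive_id t (1 : R)) (is_derive_cst t0 t (1 : R))).
  by apply: (is_derive_eq h); rewrite /GRing.scale /= subr0 mulr1.
have h := @is_derive1_comp _ (@expR R) (fun t => k * (t - t0)) t _ _ (is_derive_expR _) dl.
by apply: (is_derive_eq h); rewrite mulrC.
Qed.

Let dW c t : is_derive t (1 : R) (fun t => c / (2 * L) * W t) (c * w t).
Proof.
have h := is_deriveZ (c / (2 * L))
  (is_deriveB (is_derive_exp (2 * L) t) (is_derive_exp (- (2 * L)) t)).
apply: (is_derive_eq h); rewrite /GRing.scale /= /w mulNr opprK -mulrDr mulrA.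
by rewrite divfK // mulf_neq0 // ?gt_eqF // pnatr_eq0.
Qed.

Let w_ge1 t : 1 <= w t.
Proof.
have [t1|t1] := leP t0 t.
  by rewrite ler_wpDr ?expR_ge0 // -expR0 ler_expR mulr_ge0 ?subr_ge0 // mulr_ge0 // ltW.
rewrite ler_wpDl ?expR_ge0 // -expR0 ler_expR mulr_le0 // ?subr_le0 ?(ltW t1) //.
by rewrite oppr_le0 mulr_ge0 // ltW.
Qed.

(** Integrating the bound [c * w] from [t0] gives [c / (2 * L)] times the absolute value of [W],
    which is at most [w]. Together with the Lipschitz constant [L] this is the contraction factor
    one half. *)
Let compare (z z' dz dz' : R -> 'rV[R]_n) (c : R) : 0 <= c ->
  z t0 = z' t0 ->
  (forall t : R, is_derive t (1 : R) z (dz t)) ->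
  (forall t : R, is_derive t (1 : R) z' (dz' t)) ->
  (forall t, `|dz t - dz' t| <= c * w t) ->
  forall t, `|z t - z' t| <= c / (2 * L) * w t.
Proof.
move=> c0 zz' dzz dzz' H t.
have c20 : 0 <= c / (2 * L) by rewrite divr_ge0 // mulr_ge0 // ltW.
have W0 : W t0 = 0 by rewrite /W !subrr !mulr0 expR0 subrr.
apply: norm_le_coord => [|i].
  by rewrite mulr_ge0 // (le_trans ler01).
have dD (s : R) : is_derive s (1 : R) (fun s => (z s - z' s) 0 i) ((dz s - dz' s) 0 i).
  by apply: is_derive_coord; exact: (is_deriveB (dzz s) (dzz' s)).
have bD s : `|(dz s - dz' s) 0 i| <= c * w s by exact: le_trans (coord_le_norm _ _) (H s).
have D0 : (z t0 - z' t0) 0 i = 0 by rewrite zz' subrr mxE.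
have dNW s : is_derive s (1 : R) (fun t => - (c / (2 * L) * W t)) (- (c * w s)).
  exact: is_deriveN (dW c s).
have e1 : 0 <= expR (2 * L * (t - t0)) by exact: expR_ge0.
have e2 : 0 <= expR (- (2 * L) * (t - t0)) by exact: expR_ge0.
have Ww : W t <= w t /\ - W t <= w t by rewrite /W /w; lra.
have up a b : a <= b -> (z b - z' b) 0 i - (z a - z' a) 0 i <=
    c / (2 * L) * W b - c / (2 * L) * W a.
  move=> ab; apply: (derive_le ab (fun s _ => dD s) (fun s _ => dW c s)) => s _.
  exact: le_trans (ler_norm _) (bD s).
have dn a b : a <= b -> - (c / (2 * L) * W b) - - (c / (2 * L) * W a) <=
    (z b - z' b) 0 i - (z a - z' a) 0 i.
  move=> ab; apply: (derive_le ab (fun s _ => dNW s) (fun s _ => dD s)) => s _.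
  by have := bD s; rewrite ler_norml => /andP[].
have g1 : c / (2 * L) * W t <= c / (2 * L) * w t by rewrite ler_wpM2l //; case: Ww.
have g2 : - (c / (2 * L) * W t) <= c / (2 * L) * w t by rewrite -mulrN ler_wpM2l //; case: Ww.
rewrite ler_norml.
have [tt|/ltW tt] := leP t0 t.
  have := up _ _ tt; have := dn _ _ tt; rewrite D0 W0 mulr0; lra.
have := up _ _ tt; have := dn _ _ tt; rewrite D0 W0 mulr0; lra.
Qed.

Lemma picard : exists2 x : R -> 'rV[R]_n, x t0 = x0 &
  forall t : R, is_derive t (1 : R) x (F t (x t)).
Proof.
have B0 : 0 <= B by exact: le_trans (Fb 0 0).
(* The operator is made total so that [choice] applies; on a discontinuous [y] its value is
   irrelevant. *)
have exP (y : R -> 'rV[R]_n) : exists z : R -> 'rV[R]_n, continuous y ->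
    z t0 = x0 /\ forall t : R, is_derive t (1 : R) z (F t (y t)).
  have [cy|ncy] := pselect (continuous y); last by exists y.
  by have [H H0 dH] := antiderivative_rV t0 x0 (Fc cy); exists H.
have [P hP] := choice exP.
have cP y : continuous y -> continuous (P y).
  move=> /hP[_ d] t; apply: differentiable_continuous.
  by apply/derivable1_diffP; case: (d t).
pose x k := iter k P (fun _ => x0).
have cx k : continuous (x k).
  by elim: k => [|k IH]; [move=> t; exact: cst_continuous|exact: cP].
have xt0 k : x k t0 = x0 by case: k => [//|k]; case: (hP _ (cx k)).
have dx k (t : R) : is_derive t (1 : R) (x k.+1) (F t (x k t)).
  by case: (hP _ (cx k)) => _; apply.
pose C := B / (2 * L).
have C0 : 0 <= C by rewrite divr_ge0 // mulr_ge0 // ltW.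
have half0 m : 0 <= 2^-1 ^+ m :> R by rewrite exprn_ge0 // invr_ge0.
have w0 t : 0 <= w t by exact: le_trans ler01 (w_ge1 t).
have hstep k t : `|x k.+1 t - x k t| <= C * w t * 2^-1 ^+ k.
  elim: k t => [|k IH] t.
    rewrite expr0 mulr1.
    apply: (compare B0 (etrans (xt0 1%N) (esym (xt0 0%N))) (dx 0%N)
      (fun t => is_derive_cst x0 t (1 : R))).
    move=> s; rewrite subr0; apply: le_trans (Fb _ _) _.
    by rewrite ler_peMr.
  have c0 : 0 <= L * (C * 2^-1 ^+ k) by apply: mulr_ge0; [exact: ltW|exact: mulr_ge0].
  have := compare c0 (etrans (xt0 k.+2) (esym (xt0 k.+1))) (dx k.+1) (dx k) _ t.
  have -> : L * (C * 2^-1 ^+ k) / (2 * L) * w t = C * w t * 2^-1 ^+ k.+1.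
    by rewrite exprS; field; rewrite gt_eqF.
  apply=> s; apply: le_trans (FL _ _ _) _; rewrite -mulrA ler_wpM2l ?(ltW L0) //.
  by apply: le_trans (IH s) _; rewrite mulrAC.
have exX t : exists l, forall k, `|x k t - l| <= 2 * (C * w t) * 2^-1 ^+ k.
  apply: geometric_limit; first exact: mulr_ge0.
  by move=> k; exact: hstep.
have [X hX] := choice exX.
have lipx k a b : a <= b -> `|x k b - x k a| <= B * (b - a).
  move=> ab; have Bab : 0 <= B * (b - a) by rewrite mulr_ge0 // subr_ge0.
  case: k => [|k]; first by rewrite subrr normr0.
  apply: norm_le_coord => // i.
  have dlin (c t : R) : is_derive t (1 : R) (fun s : R => c * s) c.
    have h := is_deriveZ c (is_derive_id t (1 : R)).
    by apply: (is_derive_eq h); rewrite /GRing.scale /= mulr1.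
  have dc (t : R) := is_derive_coord i (dx k t).
  have bd t : `|F t (x k t) 0 i| <= B := le_trans (coord_le_norm _ _) (Fb _ _).
  have h1 := derive_le ab (fun t _ => dc t) (fun t _ => dlin B t)
    (fun t _ => le_trans (ler_norm _) (bd t)).
  have h2 : - B * b - - B * a <= x k.+1 b 0 i - x k.+1 a 0 i.
    apply: derive_le ab (fun t _ => dlin (- B) t) (fun t _ => dc t) _ => t _.
    by move: (bd t); rewrite ler_norml => /andP[].
  by rewrite !mxE ler_norml; apply/andP; split; lra.
(* All iterates share the Lipschitz constant [B], and the pointwise limit inherits it. Hence [X] is
   continuous and the Picard operator may be applied to it. *)
have lipX a b : a <= b -> `|X b - X a| <= B * (b - a).
  move=> ab; apply: (@le_geometric _ _ _ (2 * (C * w b) + 2 * (C * w a))) => k.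
  have h1 := lipx k _ _ ab; have h2 := hX b k; have h3 := hX a k.
  have -> : X b - X a = (x k b - x k a) - (x k b - X b) + (x k a - X a).
    by apply/rowP => i; rewrite !mxE; ring.
  apply: le_trans (ler_normD _ _) _; rewrite mulrDl addrA; apply: lerD h3.
  by apply: le_trans (ler_normB _ _) _; apply: lerD.
have cX : continuous X.
  move=> t; apply/cvgrPdist_lt => e e0.
  have B1 : 0 < B + 1 by rewrite ltr_wpDl.
  have lip1 s : `|X t - X s| <= B * `|t - s|.
    have [st|ts] := leP s t; first by rewrite (ger0_norm (_ : 0 <= t - s)) ?subr_ge0 // lipX.
    by rewrite distrC ltr0_norm ?subr_lt0 // opprB lipX // ltW.
  near=> s; apply: le_lt_trans (lip1 s) _.
  apply: (@le_lt_trans _ _ ((B + 1) * `|t - s|)).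
    by rewrite ler_wpM2r // lerDl.
  rewrite -ltr_pdivlMl // mulrC; near: s.
  by apply: cvgr_dist_lt; [exact: cvg_id|rewrite divr_gt0].
have [Z0 dZ] := hP _ cX.
(* Both [P X] and [X] are within a multiple of [2^-k] of the iterate [x k.+1], for every [k]. *)
suff ZX : P X = X by rewrite ZX in Z0 dZ; exists X.
apply/funext => t; apply/eqP; rewrite -subr_eq0 -normr_le0.
apply: (@le_geometric _ _ _ (2 * (C * w t))) => k; rewrite add0r.
have c0 : 0 <= L * (2 * C * 2^-1 ^+ k).
  by apply: mulr_ge0; [exact: ltW|apply: mulr_ge0 => //; exact: mulr_ge0].
have := compare c0 (etrans Z0 (esym (xt0 k.+1))) dZ (dx k) _ t.
have -> : L * (2 * C * 2^-1 ^+ k) / (2 * L) * w t = C * w t * 2^-1 ^+ k.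
  by field; rewrite gt_eqF.
move=> H.
have h1 : `|P X t - x k.+1 t| <= C * w t * 2^-1 ^+ k.
  apply: H => s; apply: le_trans (FL _ _ _) _; rewrite -mulrA ler_wpM2l ?(ltW L0) //.
  rewrite distrC (_ : _ * w s = 2 * (C * w s) * 2^-1 ^+ k); first exact: hX.
  by ring.
have h2 := hX t k.+1.
rewrite -(subrKA (x k.+1 t)); apply: le_trans (ler_normD _ _) _.
apply: le_trans (lerD h1 h2) _; rewrite exprS le_eqVlt; apply/orP; left; apply/eqP.
by field.
Unshelve. all: by end_near. Qed.

End Picard.

(** * Clamped fields, uniqueness and the flow *)

Section Clamp.
Variables (R : realType) (n : nat) (M : R).
Hypothesis M0 : 0 <= M.
Implicit Types x y : 'rV[R]_n.

(** Coordinatewise projection onto the cube of radius [M], the closed ball of the maximum norm.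
    Being nonexpansive, it turns a locally Lipschitz field into a bounded, globally Lipschitz
    one. *)
Definition clamp x : 'rV[R]_n := \row_i Num.max (- M) (Num.min (x 0 i) M).

Lemma norm_clamp x : `|clamp x| <= M.
Proof.
apply: norm_le_coord => // i; rewrite mxE ler_norml.
rewrite le_max lexx /= ge_max (le_trans _ M0) ?oppr_le0 //.
by rewrite ge_min lexx orbT.
Qed.

Lemma clamp_id x : `|x| <= M -> clamp x = x.
Proof.
move=> xM; apply/rowP => i; rewrite mxE.
have := le_trans (coord_le_norm x i) xM; rewrite ler_norml => /andP[h1 h2].
by rewrite (min_idPl h2) (max_idPr h1).
Qed.

Lemma clamp_lipschitz x y : `|clamp x - clamp y| <= `|x - y|.
Proof.
apply: norm_le_coord => // i; apply: le_trans (coord_le_norm _ i).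
rewrite !mxE; move: (x 0 i) (y 0 i) => a b.
have /andP[h2 h1] : - `|a - b| <= a - b <= `|a - b| by rewrite -ler_norml.
move: `|a - b| h1 h2 => d h1 h2; have d0 : 0 <= d by lra.
rewrite ler_norml !minEle !maxEle.
case: (leP a M) => aM; case: (leP b M) => bM;
  do ?[case: (leP (- M) _) => ?]; by apply/andP; split; lra.
Qed.

End Clamp.

Section Uniqueness.
Variables (R : realType) (n : nat) (f : 'rV[R]_n * R -> 'rV[R]_n).
Hypothesis hf : continuously_differentiable f.

Lemma is_derive_bounded (x dx : R -> 'rV[R]_n) (a b : R) :
  (forall t, a <= t <= b -> is_derive t 1 x (dx t)) ->
  exists M, forall t, a <= t <= b -> `|x t| <= M.
Proof.
move=> dxx.
have : compact (x @` `[a, b]).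
  apply: continuous_compact; last exact: segment_compact.
  apply: derivable_within_continuous => t; rewrite in_itv /= => /dxx.
  by case.
move=> /compact_bounded[M [Mr hM]]; exists (M + 1) => t tab.
by apply: hM; [rewrite ltrDl|exists t => //=; rewrite in_itv].
Qed.

(** The constants depend on the common bound [M] alone, not on the interval or the solutions. Two
    different parameter curves are allowed so that a solution of the ramped system can be compared
    with one of the limiting system. *)
Lemma continuous_dependence (M : R) : exists L C : R, 0 <= L /\
  forall (a b e : R) (x y : R -> 'rV[R]_n) (l k : R -> R), a <= b -> 0 <= e ->
  (forall t, a <= t <= b -> is_derive t 1 x (f (x t, l t))) ->
  (forall t, a <= t <= b -> is_derive t 1 y (f (y t, k t))) ->
  (forall t, a <= t <= b -> `|x t| <= M) ->
  (forall t, a <= t <= b -> `|y t| <= M) ->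
  (forall t, a <= t <= b -> `|l t| <= M) ->
  (forall t, a <= t <= b -> `|k t| <= M) ->
  (forall t, a <= t <= b -> `|l t - k t| <= e) ->
  dot (x b - y b) (x b - y b) <=
    (dot (x a - y a) (x a - y a) + (L * e) ^+ 2) * expR (C * (b - a)).
Proof.
have [L L0 hL] := lipschitz_ball hf M.
exists L, (n%:R * (2 * L + 1)); split => // a b e x y l k ab e0 dx dy xM yM lM kM lk.
apply: (@gronwall_rV _ _ (fun t => x t - y t) (fun t => f (x t, l t) - f (y t, k t))
  L (L * e) a b) => //.
- exact: mulr_ge0.
- by move=> t tab; exact: is_deriveB (dx t tab) (dy t tab).
- move=> t tab; apply: le_trans (hL _ _ _ _ (xM _ tab) (yM _ tab) (lM _ tab) (kM _ tab)) _.
  rewrite -mulrDr ler_wpM2l // ge_max lerDl e0 /=.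
  by rewrite ler_wpDl // lk.
Qed.

Lemma dot_eq0 (u : 'rV[R]_n) : dot u u <= 0 -> u = 0.
Proof.
move=> u0; apply/eqP; rewrite -normr_eq0 -sqrf_eq0 eq_le sqr_ge0 andbT.
exact: le_trans (norm_sqr_le_dot u) u0.
Qed.

Lemma ode_unique (l : R -> R) (Lam a b : R) (x y : R -> 'rV[R]_n) :
  (forall t, `|l t| <= Lam) -> a <= b ->
  (forall t, a <= t <= b -> is_derive t 1 x (f (x t, l t))) ->
  (forall t, a <= t <= b -> is_derive t 1 y (f (y t, l t))) ->
  x a = y a -> x b = y b.
Proof.
move=> lL ab dx dy xya.
have [M1 h1] := is_derive_bounded dx.
have [M2 h2] := is_derive_bounded dy.
pose M := Num.max (Num.max M1 M2) Lam.
have [L [C [L0 H]]] := continuous_dependence M.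
have := H a b 0 x y l l ab (lexx 0) dx dy.
rewrite xya subrr mulr0 expr0n /= addr0 {2}/dot big1 ?mul0r; last first.
  by move=> j _; rewrite mxE mul0r.
move=> H1; apply/eqP; rewrite -subr_eq0; apply/eqP/dot_eq0; apply: H1 => t tab.
- by rewrite !le_max h1.
- by rewrite !le_max h2 // orbT.
- by rewrite !le_max lL !orbT.
- by rewrite !le_max lL !orbT.
- by rewrite subrr normr0.
Qed.

End Uniqueness.

Section Cutoff.
Variables (R : realType) (n : nat) (f : 'rV[R]_n * R -> 'rV[R]_n).
Hypothesis hf : continuously_differentiable f.
Variables (lam : R -> R) (r Lam : R).
Hypotheses (lamc : continuous lam) (lamb : forall s, `|lam s| <= Lam).

(** Clamped solutions exist for all times and solve the true equation as long as they stay in the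
    cube, so any a priori bound below [M] yields existence for the true equation. *)
Definition cutoff_solution (M : R) (z : R -> 'rV[R]_n) : Prop :=
  forall t : R, is_derive t (1 : R) z (f (clamp M (z t), lam (r * t))).

Lemma cutoff_exists (M t0 : R) (x0 : 'rV[R]_n) : 0 <= M ->
  exists2 z : R -> 'rV[R]_n, z t0 = x0 & cutoff_solution M z.
Proof.
move=> M0.
pose M' := Num.max M Lam.
have [L L0 hL] := lipschitz_ball hf M'.
have cM (x : 'rV[R]_n) : `|clamp M x| <= M' :> R by rewrite le_max norm_clamp.
have lM t : `|lam (r * t)| <= M' by rewrite le_max lamb orbT.
(* The bound on the field is its size at one point plus the Lipschitz constant times the diameter
   [2 * M']. Taking [L + 1] makes that constant strictly positive, as [picard] requires. *)
have [|||t x y|z z0 dz] := @picard R n (fun t x => f (clamp M x, lam (r * t)))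
  (`|f (clamp M 0, lam 0)| + (L + 1) * (2 * M')) (L + 1) _ _ _ _ t0 x0.
- by rewrite ltr_wpDl.
- move=> x cx t; apply: (@continuous_comp _ _ _
    (fun t => (clamp M (x t), lam (r * t))) f); last first.
    exact: differentiable_continuous (hf.1 _).
  have c1 : clamp M (x s) @[s --> t] --> clamp M (x t).
    apply: (@continuous_comp _ _ _ x (clamp M)); first exact: cx.
    apply/(@cvgrPdist_lt _ _ _ (nbhs (x t))) => e e0; near=> y'.
    apply: le_lt_trans (clamp_lipschitz _ _ _) _.
    by near: y'; apply: cvgr_dist_lt => //; exact: cvg_id.
  have c2 : lam (r * s) @[s --> t] --> lam (r * t).
    apply: (@continuous_comp _ _ _ (fun t => r * t) lam); last exact: lamc.
    exact: mulrl_continuous.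
  exact: (cvg_pair c1 c2).
- move=> t x; rewrite -[f (_, _)](subrK (f (clamp M 0, lam 0))) addrC.
  rewrite (le_trans (ler_normD _ _)) // lerD2l.
  have lM0 : `|lam 0| <= M' by rewrite -(mulr0 r).
  apply: le_trans (hL _ _ _ _ (cM x) (cM 0) (lM t) lM0) _.
  apply: ler_pM => //; first by rewrite lerDl.
  rewrite ge_max mulr2n mulrDl mul1r.
  by apply/andP; split; apply: le_trans (ler_normB _ _) _; apply: lerD.
- apply: le_trans (hL _ _ _ _ (cM x) (cM y) (lM t) (lM t)) _.
  rewrite subrr normr0 (max_idPl _) //.
  apply: ler_pM => //; [by rewrite lerDl|exact: clamp_lipschitz].
by exists z.
Unshelve. all: by end_near. Qed.

Lemma reaches_unique (a b : R) (x0 y1 y2 : 'rV[R]_n) : a <= b ->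
  reaches (ramped f lam r) a x0 b y1 -> reaches (ramped f lam r) a x0 b y2 ->
  y1 = y2.
Proof.
move=> ab [D1 [x1 [ [op1 i1 s1] a1 b1 x1a x1b]]] [D2 [x2 [ [op2 i2 s2] a2 b2 x2a x2b]]].
rewrite -x1b -x2b.
apply: (@ode_unique _ _ _ hf (fun t => lam (r * t)) Lam a b) => //; last by rewrite x1a.
  move=> t tab; apply: s1; exact: i1 tab.
move=> t tab; apply: s2; exact: i2 tab.
Qed.

Lemma flow_unique (a b : R) (x0 y : 'rV[R]_n) : a <= b ->
  reaches (ramped f lam r) a x0 b y -> flow (ramped f lam r) a x0 b = y.
Proof.
move=> ab h; have h' : reaches (ramped f lam r) a x0 b (flow (ramped f lam r) a x0 b).
  exact: (@xgetPex _ 0 [set y | reaches (ramped f lam r) a x0 b y] (ex_intro _ _ h)).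
exact: reaches_unique ab h' h.
Qed.

(** A [solution] lives on an open interval, whereas the bound is known on a closed one. Since the
    bound is strict, continuity carries it a little beyond both ends. *)
Lemma reaches_cutoff (M : R) (z : R -> 'rV[R]_n) (a b : R) : a <= b ->
  cutoff_solution M z -> (forall t, a <= t <= b -> `|z t| < M) ->
  reaches (ramped f lam r) a (z a) b (z b).
Proof.
move=> ab dz zM.
have cz : continuous z.
  move=> t; apply: differentiable_continuous.
  by apply/derivable1_diffP; case: (dz t).
have nb t : a <= t <= b -> exists2 e : R, 0 < e & forall s, `|t - s| < e -> `|z s| < M.
  move=> tab; have : nbhs t [set s | `|z s| < M].
    have ct : `|z s| @[s --> t] --> `|z t| by apply: cvg_norm; exact: cz.
    by apply: (cvgr_lt _ ct); exact: zM.
  by move=> /nbhs_ballP[e e0 he]; exists e => // s ts; apply: he.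
have [e1 e10 h1] := nb a (introT andP (conj (lexx a) ab)).
have [e2 e20 h2] := nb b (introT andP (conj ab (lexx b))).
exists `]a - e1, b + e2[%classic, z; split => //.
- split; [exact: interval_open|exact: interval_is_interval|].
  move=> t; rewrite /= in_itv /= => /andP[t1 t2].
  have zt : `|z t| < M.
    have [ta|ta] := leP a t; last by apply: h1; rewrite ger0_norm; lra.
    have [tb|tb] := leP t b; first by apply: zM; rewrite ta.
    by apply: h2; rewrite ltr0_norm; lra.
  by have := dz t; rewrite clamp_id // ltW.
- by rewrite /= in_itv /= ltrBlDr ltrDl e10 (le_lt_trans ab) // ltrDl.
- by rewrite /= in_itv /= ltrDl e20 (lt_le_trans _ ab) // ltrBlDr ltrDl.
Qed.

End Cutoff.

(** * Asymptotic stability *)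

Section RealInduction.
Variable R : realType.

(** At the infimum of the counterexamples the hypothesis applies and excludes further ones just to
    the right, which contradicts the choice of the infimum. *)
Lemma real_induction (a : R) (P : R -> Prop) :
  (forall t, a <= t -> (forall s, a <= s < t -> P s) ->
    P t /\ exists2 e, 0 < e & forall s, t < s < t + e -> P s) ->
  forall t, a <= t -> P t.
Proof.
move=> H t at_; apply: contrapT => nPt.
pose E := [set s | a <= s /\ ~ P s].
have Et : E t by [].
have lbE : lbound E a by move=> s [].
have hlb : has_lbound E by exists a.
have aT : a <= inf E by apply: lb_le_inf lbE; exists t.
have below s : a <= s < inf E -> P s.
  move=> /andP[as_ sT]; apply: contrapT => nPs.
  by have := ge_inf hlb (conj as_ nPs : E s); rewrite leNgt sT.
have [PT [e e0 he]] := H _ aT below.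
suff : inf E + e <= inf E by rewrite gerDl leNgt e0.
apply: lb_le_inf; first by exists t.
move=> s [as_ nPs]; rewrite leNgt; apply/negP => sTe; apply: nPs.
have [sT|Ts] := ltP s (inf E); first by apply: below; rewrite as_.
move: Ts; rewrite le_eqVlt => /orP[/eqP <- //|Ts].
by apply: he; rewrite Ts.
Qed.

Lemma closed_left_limit (T : topologicalType) (z : R -> T) (C : set T) (a t : R) :
  closed C -> {for t, continuous z} -> a < t ->
  (forall s, a <= s < t -> C (z s)) -> C (z t).
Proof.
move=> clC zt at_ H; apply: clC => B /zt /= /nbhs_ballP[e e0 he].
pose s := Num.max a (t - e / 2).
have e2 : 0 < e / 2 by rewrite divr_gt0.
have st : s < t by rewrite gt_max at_ /= ltrBlDr ltrDl.
exists (z s); split; first by apply: H; rewrite st le_max lexx.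
apply: he; rewrite /ball /= ger0_norm ?subr_ge0 ?(ltW st) //.
have : t - e / 2 <= s by rewrite le_max lexx orbT.
lra.
Qed.

Lemma is_derive_continuous n (z : R -> 'rV[R]_n) (t : R) (v : 'rV[R]_n) :
  is_derive t (1 : R) z v -> {for t, continuous z}.
Proof.
by case=> d _; apply: differentiable_continuous; apply/derivable1_diffP.
Qed.

(** The differential inequality is available only while [v <= rho], so confinement must come first:
    real induction shows that [v] never reaches [rho]. Convergence then follows from the same decay
    estimate, started when the forcing [k] has become small. *)
Lemma scalar_stability (v dv k : R -> R) (al rho a : R) : 0 < al ->
  (forall t, a <= t -> is_derive t (1 : R) v (dv t)) ->
  (forall t, a <= t -> v t <= rho -> dv t <= - al * v t + k t) ->
  (forall t, a <= t -> k t <= al * rho / 2) ->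
  k t @[t --> +oo] --> (0 : R) ->
  0 <= v a < rho ->
  (forall t, a <= t -> v t < rho) /\
  forall e, 0 < e -> \forall t \near +oo, v t < e.
Proof.
move=> al0 dvv dvle kle k0 /andP[va0 va].
have rho0 : 0 < rho by apply: le_lt_trans va.
have decay p b t : a <= b -> b <= t -> (forall s, b <= s <= t -> v s <= rho) ->
    (forall s, b <= s <= t -> k s <= al * p) ->
    v t <= (v b - p) * expR (- al * (t - b)) + p.
  move=> ab bt vr kp; rewrite -lerBlDr.
  have as_ s : b <= s <= t -> a <= s by move=> /andP[bs _]; exact: le_trans bs.
  apply: (@gronwall _ (fun s => v s - p) dv (- al) b t bt).
    move=> s bst; have h := is_deriveB (dvv s (as_ s bst)) (is_derive_cst p s (1 : R)).
    by apply: (is_derive_eq h); rewrite subr0.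
  move=> s bst; apply: le_trans (dvle s (as_ s bst) (vr s bst)) _.
  by have := kp s bst; lra.
have cv t : a <= t -> {for t, continuous v}.
  move=> /dvv[d _]; apply: differentiable_continuous; exact/derivable1_diffP.
(* The forcing is at most [al * (rho / 2)], so [v] relaxes towards [rho / 2] and cannot exceed the
   larger of this level and its initial value. *)
pose q := Num.max (v a) (rho / 2).
have q_lt : q < rho by rewrite gt_max va /= ltr_pdivrMr //; lra.
have stay : forall t, a <= t -> v t < rho.
  apply: real_induction => t at_ IH.
  have vt : v t <= q.
    move: at_; rewrite le_eqVlt => /orP[/eqP <-|at_]; first by rewrite le_max lexx.
    apply: (closed_left_limit (@closed_le _ q) (cv _ (ltW at_)) at_) => s /andP[as_ st] /=.
    have := decay (rho / 2) a s (lexx a) as_ _ _.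
    have e0 := expR_ge0 (- al * (s - a)).
    have e1 : expR (- al * (s - a)) <= 1.
      rewrite -expR0 ler_expR mulNr oppr_le0 mulr_ge0 ?(ltW al0) //; lra.
    have qa : v a <= q by rewrite le_max lexx.
    have qr : rho / 2 <= q by rewrite le_max lexx orbT.
    have h1 u : a <= u <= s -> v u <= rho.
      by move=> /andP[au us]; apply/ltW/IH; rewrite au (le_lt_trans us).
    have h2 u : a <= u <= s -> k u <= al * (rho / 2).
      by move=> /andP[au us]; rewrite mulrA; exact: kle.
    move=> /(_ h1 h2) /le_trans; apply.
    by move: (expR _) e0 e1 => y e0 e1; nra.
  have vlt : v t < rho by exact: le_lt_trans q_lt.
  split=> //.
  have : nbhs t [set s | v s < rho] by exact: (cvgr_lt _ (cv _ at_)) vlt.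
  move=> /nbhs_ballP[e e0 he]; exists e => // s /andP[ts ste]; apply: he.
  by rewrite /ball /= ltr0_norm ?subr_lt0 // opprB ltrBlDl.
split=> // e e0.
have e40 : 0 < al * (e / 2) by rewrite mulr_gt0 // divr_gt0.
have [T0 [_ hT0]] := cvgr_lt _ k0 _ e40.
pose b := Num.max a (T0 + 1).
have ab : a <= b by rewrite le_max lexx.
have T0b : T0 < b by rewrite lt_max ltrDl ltr01 orbT.
(* After this waiting time [1 + al * (t - b)] exceeds [2 * rho / e], hence so does the exponential,
   and the contribution of the initial value falls below [e / 2]. *)
exists (b + 2 * rho / (e * al)); split; first exact: num_real.
move=> t bt.
have eal : 0 < e * al by exact: mulr_gt0.
have bt' : b <= t.
  apply: ltW; apply: le_lt_trans bt; rewrite lerDl divr_ge0 // ?mulr_ge0 // ltW //.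
have h := decay (e / 2) b t ab bt'.
have h1 u : b <= u <= t -> v u <= rho.
  by move=> /andP[bu _]; apply/ltW/stay; exact: le_trans bu.
have h2 u : b <= u <= t -> k u <= al * (e / 2).
  by move=> /andP[bu _]; apply/ltW/hT0; exact: lt_le_trans bu.
have {}h := h h1 h2.
have E := expR_ge1Dx (al * (t - b)).
have E1 : expR (- al * (t - b)) * expR (al * (t - b)) = 1.
  by rewrite -expRD mulNr addNr expR0.
have y0 := expR_gt0 (- al * (t - b)).
have rt : 2 * rho < (t - b) * (e * al).
  by move: bt; rewrite addrC -ltrBrDr ltr_pdivrMr.
have vb := stay b ab.
move: (expR (al * (t - b))) (expR (- al * (t - b))) E E1 y0 h => Y y E E1 y0 h.
have hy : rho * y < e / 2.
  have : rho * y < (e / 2 * Y) * y by rewrite ltr_pM2r //; nra.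
  by rewrite -mulrA (mulrC Y) E1 mulr1.
nra.
Qed.

End RealInduction.

(** * Local attraction under a converging parameter *)

Section LocalStability.
Variables (R : realType) (n : nat) (f : 'rV[R]_n * R -> 'rV[R]_n).
Hypothesis hf : continuously_differentiable f.

Lemma mulmxr_bounded m k (Q : 'M[R]_(m, k)) :
  exists2 K : R, 0 < K & forall x : 'rV_m, `|x *m Q| <= K * `|x|.
Proof.
exists (1 + \sum_j \sum_i `|Q i j|).
  by rewrite ltr_wpDr // sumr_ge0 // => j _; rewrite sumr_ge0.
have S0 : 0 <= \sum_j \sum_i `|Q i j| by rewrite sumr_ge0 // => j _; rewrite sumr_ge0.
move=> x; apply: norm_le_coord => [|j]; first by rewrite mulr_ge0 // addr_ge0.
rewrite mxE; apply: le_trans (ler_norm_sum _ _ _) _.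
apply: (@le_trans _ _ (\sum_i `|Q i j| * `|x|)).
  by apply: ler_sum => i _; rewrite normrM mulrC ler_wpM2l ?coord_le_norm.
rewrite -mulr_suml ler_wpM2r // ler_wpDl // (bigD1 j) //= lerDl.
by rewrite sumr_ge0 // => j' _; rewrite sumr_ge0.
Qed.

Lemma linearization (g : 'rV[R]_n -> 'rV[R]_n) (p : 'rV[R]_n) (e : R) :
  differentiable g p -> 0 < e -> exists2 d, 0 < d & forall x, `|x - p| < d ->
    `|g x - g p - (x - p) *m jacobian g p| <= e * `|x - p|.
Proof.
move=> dg e0.
have := diff_locally dg => /eqaddoP /(_ e e0) /nbhs_normP[d d0 hd].
exists d => // x xp; have := hd (x - p).
rewrite /ball_ /= sub0r normrN => /(_ xp).
have -> : (x - p) *m jacobian g p = 'd g p (x - p) by rewrite mul_rV_lin1.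
rewrite [X in `|X| <= _](_ : _ = g x - g p - 'd g p (x - p)) //.
transitivity (g (x - p + p) - (g p + ('d g p (x - p) : 'rV[R]_n))); first by [].
by rewrite subrK opprD addrA.
Qed.

Lemma frozen_differentiable (l : R) (p : 'rV[R]_n) :
  differentiable (fun y => f (y, l)) p.
Proof.
apply: (@differentiable_comp _ _ _ _ (fun y => (y, l)) f); last exact: hf.1.
by apply: differentiable_pair.
Qed.

(** The field is split into its linear part at [p], the remainder [o1] of the linearization and the
    effect [o2] of the parameter. In the derivative of the quadratic form the linear part gives
    [- 2 * al], the remainder costs at most [al], and the parameter enters as forcing. *)
Lemma lyapunov_inequality (l0 : R) (p : 'rV[R]_n) :
  attracting_hyperbolic_equilibrium f l0 p ->
  exists m (Q : 'M[R]_(n, m)) (al c K d : R),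
    [/\ [/\ 0 < al, 0 <= c, 0 < K & 0 < d],
        forall x : 'rV_n, `|x| ^+ 2 <= K * dot (x *m Q) (x *m Q) /\
                          dot (x *m Q) (x *m Q) <= K * `|x| ^+ 2 &
        forall x l, `|x - p| < d -> `|l - l0| < d ->
          2 * dot ((x - p) *m Q) (f (x, l) *m Q) <=
          - al * dot ((x - p) *m Q) ((x - p) *m Q) + c * `|l - l0|].
Proof.
case=> fp0 hA.
have [m [Q [Q' [al [al0 QQ' hQ]]]]] := lyapunov_form hA.
have [K1 K10 hK1] := mulmxr_bounded Q.
have [K2 K20 hK2] := mulmxr_bounded Q'.
have hQ' (x : 'rV_n) : `|x| <= K2 * `|x *m Q|.
  by rewrite -{1}[x]mulmx1 -QQ' mulmxA; exact: hK2.
(* The added one keeps this factor positive when [m] is zero; [e] below is chosen so that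
   [m1 * K1 * e * K2 = al / 2]. *)
pose m1 : R := m%:R + 1.
have m10 : 0 < m1 by rewrite ltr_wpDl.
pose e := al / (2 * m1 * K1 * K2).
have e0 : 0 < e by rewrite divr_gt0 // !mulr_gt0.
have [d1 d10 hd1] := linearization (frozen_differentiable l0 p) e0.
(* This radius covers every state within one of [p] and every parameter within one of [l0], which is
   why [d] is at most one. *)
have [L L0 hL] := lipschitz_ball hf (`|p| + `|l0| + 1).
pose d := Num.min d1 1.
have d0 : 0 < d by rewrite lt_min d10 ltr01.
exists m, Q, al, (2 * m1 * K1 * K1 * L), (K2 ^+ 2 + m1 * K1 ^+ 2), d; split.
- split => //; first by rewrite !mulr_ge0 // ltW.
  by rewrite ltr_wpDl ?sqr_ge0 // mulr_gt0 // exprn_gt0.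
- move=> x; have hx := norm_sqr_le_dot (x *m Q); split.
    apply: (@le_trans _ _ (K2 ^+ 2 * `|x *m Q| ^+ 2)).
      by rewrite -exprMn lerXn2r ?nnegrE // mulr_ge0 // ltW.
    apply: (@le_trans _ _ (K2 ^+ 2 * dot (x *m Q) (x *m Q))).
      by rewrite ler_wpM2l // sqr_ge0.
    rewrite ler_wpM2r ?dot_ge0 // lerDl mulr_ge0 ?sqr_ge0 // ltW //.
  apply: le_trans (dot_le_norm _ _) _.
  apply: (@le_trans _ _ (m1 * K1 ^+ 2 * `|x| ^+ 2)); last first.
    by rewrite ler_wpM2r ?sqr_ge0 // lerDr sqr_ge0.
  rewrite -mulrA -exprMn expr2 ler_pM ?mulr_ge0 ?ler0n // ?lerDl //.
  by rewrite ler_pM.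
move=> x l; rewrite !lt_min => /andP[xd1 x1] /andP[_ l1].
set y := x - p.
have yE : `|y| = `|x - p| by [].
pose o1 := f (x, l0) - f (p, l0) - y *m jacobian (fun z => f (z, l0)) p.
pose o2 := f (x, l) - f (x, l0).
have fE : f (x, l) = y *m jacobian (fun z => f (z, l0)) p + o1 + o2.
  by rewrite /o1 /o2 fp0; apply/rowP => i; rewrite !mxE; ring.
have xM : `|x| <= `|p| + `|l0| + 1.
  rewrite -[x](subrK p) (le_trans (ler_normD _ _)) //.
  by have := normr_ge0 l0; lra.
have lM : `|l| <= `|p| + `|l0| + 1.
  rewrite -[l](subrK l0) (le_trans (ler_normD _ _)) //.
  by have := normr_ge0 p; lra.
have l0M : `|l0| <= `|p| + `|l0| + 1 by have := normr_ge0 p; lra.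
have bo1 : `|o1| <= e * `|y| by exact: hd1.
have bo2 : `|o2| <= L * `|l - l0|.
  apply: le_trans (hL _ _ _ _ xM xM lM l0M) _.
  by rewrite subrr normr0 (max_idPr _).
have dotD u v w : dot u (v + w) = dot u v + dot u w :> R.
  by rewrite /dot -big_split; apply: eq_bigr => i _; rewrite mxE mulrDr.
have distr u v1 v2 v3 : dot u ((v1 + v2 + v3) *m Q) =
    dot u (v1 *m Q) + dot u (v2 *m Q) + dot u (v3 *m Q) by rewrite !mulmxDl !dotD.
rewrite fE distr.
have h0 := hQ y.
have bnd o : dot (y *m Q) (o *m Q) <= m1 * (`|y *m Q| * (K1 * `|o|)).
  apply: le_trans (dot_le_norm _ _) _.
  by rewrite ler_pM ?mulr_ge0 ?ler0n // ?lerDl // ler_wpM2l.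
have h1 : dot (y *m Q) (o1 *m Q) <= al / 2 * dot (y *m Q) (y *m Q).
  apply: le_trans (bnd _) _.
  apply: (@le_trans _ _ (m1 * (`|y *m Q| * (K1 * (e * (K2 * `|y *m Q|)))))).
    rewrite ler_wpM2l ?(ltW m10) // ler_wpM2l // ler_wpM2l ?(ltW K10) //.
    by apply: le_trans bo1 _; rewrite ler_wpM2l ?(ltW e0).
  apply: (@le_trans _ _ (al / 2 * `|y *m Q| ^+ 2)).
    rewrite /e le_eqVlt; apply/orP; left; apply/eqP; field.
    by rewrite !gt_eqF.
  by rewrite ler_wpM2l ?norm_sqr_le_dot // divr_ge0 // ltW.
have h2 : dot (y *m Q) (o2 *m Q) <= m1 * K1 * K1 * L * `|l - l0|.
  apply: le_trans (bnd _) _.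
  rewrite -!mulrA ler_wpM2l ?(ltW m10) //; apply: ler_pM => //.
  - by rewrite mulr_ge0 // ltW.
  - by rewrite -[leRHS]mulr1; apply: le_trans (hK1 y) _; rewrite ler_wpM2l // ltW.
  - by rewrite ler_wpM2l // ltW.
move: h0 h1 h2; rewrite -/y.
move: (dot _ (o1 *m Q)) (dot _ (o2 *m Q)) => B C.
move: (dot _ (_ *m _ *m Q)) => A; move: (dot _ _) => D; lra.
Qed.

(** The equation is imposed on [z] only while [z] is within [e] of [p], so that clamped solutions
    are covered before they are known to stay in the cube. The numbers [d] and [T] serve all
    starting times and all such curves. *)
Lemma attract_near (l0 : R) (p : 'rV[R]_n) (l : R -> R) (e : R) :
  attracting_hyperbolic_equilibrium f l0 p -> l t @[t --> +oo] --> l0 -> 0 < e ->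
  exists (d T : R), 0 < d /\ forall (a : R) (z dz : R -> 'rV[R]_n), T <= a ->
    (forall t : R, a <= t -> is_derive t (1 : R) z (dz t)) ->
    (forall t : R, a <= t -> `|z t - p| < e -> dz t = f (z t, l t)) ->
    `|z a - p| < d ->
    (forall t, a <= t -> `|z t - p| < e) /\ z t @[t --> +oo] --> p.
Proof.
move=> hp ll0 e0.
have [m [Q [al [c [K [d [[al0 c0 K0 d0] normQ hQ]]]]]]] := lyapunov_inequality hp.
pose r := Num.min d e.
have r0 : 0 < r by rewrite lt_min d0 e0.
(* On the sublevel set [V x <= rho] the squared distance to [p] is at most [K * rho = r ^+ 2 / 2],
   so the set lies inside the ball of radius [r]. *)
pose rho := r ^+ 2 / (2 * K).
have rho0 : 0 < rho by rewrite divr_gt0 ?exprn_gt0 ?mulr_gt0.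
pose V x := dot ((x - p) *m Q) ((x - p) *m Q).
have Vr x : V x <= rho -> `|x - p| < r.
  move=> Vx; rewrite -(ltr_pXn2r (_ : 0 < 2)%N) ?nnegrE ?(ltW r0) //.
  apply: le_lt_trans (normQ _).1 _; apply: (@le_lt_trans _ _ (K * rho)).
    by rewrite ler_wpM2l // ltW.
  have -> : K * rho = r ^+ 2 / 2 by rewrite /rho; field; rewrite gt_eqF.
  by rewrite ltr_pdivrMr // ltr_pMr ?exprn_gt0 // ltr1n.
(* The bound by one lets the distance replace its square, so that [V] is at most [rho / 2] without a
   square root in the definition of [d']. *)
pose d' := Num.min 1 (rho / (2 * K)).
have d'0 : 0 < d' by rewrite lt_min ltr01 divr_gt0 // mulr_gt0.
have Vd x : `|x - p| < d' -> V x < rho.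
  rewrite lt_min => /andP[x1 xr]; apply: le_lt_trans (normQ _).2 _.
  apply: (@le_lt_trans _ _ (K * (rho / (2 * K)))).
    rewrite ler_wpM2l ?(ltW K0) //; apply: le_trans (ltW xr).
    by rewrite expr2 ler_piMr // ltW.
  have -> : K * (rho / (2 * K)) = rho / 2 by field; rewrite gt_eqF.
  by rewrite ltr_pdivrMr // ltr_pMr // ltr1n.
have kap : c * `|l t - l0| @[t --> +oo] --> (0 : R).
  rewrite -(mulr0 c); apply: cvgMr.
  by rewrite -(normr0 R) -(subrr l0); apply: cvg_norm; apply: cvgB => //; exact: cvg_cst.
have kb : 0 < al * rho / 2 by rewrite divr_gt0 // mulr_gt0.
have [T1 [_ hT1]] := cvgr_lt _ kap _ kb.
have [T2 [_ hT2]] : \forall t \near +oo, `|l0 - l t| < d by apply: cvgr_dist_lt.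
exists d', (Num.max T1 T2 + 1); split => // a z dz Ta dzz dzf za.
have Tt t : a <= t -> T1 < t /\ T2 < t.
  move=> at_; have : Num.max T1 T2 < t by apply: lt_le_trans at_; lra.
  by rewrite gt_max => /andP[].
have dV t : a <= t -> is_derive t (1 : R) (fun s => V (z s))
    (2 * dot ((z t - p) *m Q) (dz t *m Q)).
  move=> at_; have h := is_deriveB (dzz t at_) (is_derive_cst p t (1 : R)).
  have := is_derive_dot (is_derive_mulmxr Q h).
  by rewrite subr0.
have := @scalar_stability R (fun t => V (z t)) _ (fun t => c * `|l t - l0|) al rho a al0 dV.
case => //.
- move=> t at_ Vt.
  have zr := Vr _ Vt; rewrite dzf //; last first.
    by apply: lt_le_trans zr _; rewrite ge_min lexx orbT.
  apply: hQ; first by apply: lt_le_trans zr _; rewrite ge_min lexx.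
  by rewrite distrC; apply: hT2; case: (Tt t at_).
- by move=> t at_; apply/ltW/hT1; case: (Tt t at_).
- by rewrite dot_ge0 Vd.
move=> stay small; split.
  by move=> t at_; apply: lt_le_trans (Vr _ (ltW (stay t at_))) _; rewrite ge_min lexx orbT.
apply/cvgrPdist_lt => eps eps0.
have eK : 0 < eps ^+ 2 / K by rewrite divr_gt0 // exprn_gt0.
have := small _ eK; apply: filterS => t Vt.
rewrite distrC -(ltr_pXn2r (_ : 0 < 2)%N) ?nnegrE ?(ltW eps0) //.
by apply: le_lt_trans (normQ _).1 _; rewrite mulrC -ltr_pdivlMr.
Qed.

End LocalStability.

(** * Trapping and convergence *)

Section OmegaLimit.
Variables (R : realType) (n : nat) (f : 'rV[R]_n * R -> 'rV[R]_n).
Hypothesis hf : continuously_differentiable f.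

Lemma is_derive_translate (z : R -> 'rV[R]_n) (t s : R) (v : 'rV[R]_n) :
  is_derive (t + s) (1 : R) z v -> is_derive s (1 : R) (fun s => z (t + s)) v.
Proof.
have E : (fun h : R => h^-1 *: (((fun s => z (t + s)) \o shift s) (h *: (1 : R))
             - z (t + s))) =
         (fun h : R => h^-1 *: ((z \o shift (t + s)) (h *: (1 : R)) - z (t + s))).
  by apply/funext => h0 /=; congr (_ *: (z _ - _)); rewrite addrCA.
case=> h1 h2; split; first by rewrite /derivable E.
by rewrite -h2 /derive E.
Qed.

(* The limiting orbit through a cluster point of z comes close to p, and z
   shadows it, since z eventually almost solves the limiting equation. *)
Lemma basin_approach (l0 Lam a : R) (p : 'rV[R]_n) (l : R -> R)
    (K : set 'rV[R]_n) (z : R -> 'rV[R]_n) :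
  l t @[t --> +oo] --> l0 -> (forall t, `|l t| <= Lam) ->
  compact K -> K `<=` basin f l0 p ->
  (forall t : R, a <= t -> is_derive t (1 : R) z (f (z t, l t))) ->
  (forall t, a <= t -> K (z t)) ->
  forall d T, 0 < d -> exists2 t, T <= t & `|z t - p| < d.
Proof.
move=> ll0 lb cK Kb dz zK d T d0.
have [|q [Kq clq]] := cK (z @ +oo_R) _.
  exists a; split; first exact: num_real.
  by move=> t at_; apply: zK; exact: ltW.
have [ex cvq] := Kb q Kq.
have d2 : 0 < d / 2 by rewrite divr_gt0.
have [tau tau0 htau] : exists2 tau, 0 <= tau &
    `|flow (frozen f l0) 0 q tau - p| < d / 2.
  have [T0 [_ hT0]] : \forall t \near +oo, `|p - flow (frozen f l0) 0 q t| < d / 2.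
    by apply: cvgr_dist_lt.
  exists (Num.max 0 (T0 + 1)); first by rewrite le_max lexx.
  by rewrite distrC; apply: hT0; rewrite lt_max ltrDl ltr01 orbT.
have [D [x [[oD iD dx] D0 Dtau x0 xtau]]] : reaches (frozen f l0) 0 q tau
    (flow (frozen f l0) 0 q tau).
  exact: (@xgetPex _ 0 [set y | reaches (frozen f l0) 0 q tau y] (ex tau tau0)).
have dxs s : 0 <= s <= tau -> is_derive s (1 : R) x (f (x s, l0)).
  by move=> stau; apply: dx; exact: iD stau.
have [M1 hM1] := is_derive_bounded dxs.
have [M2 [_ hM2]] := compact_bounded cK.
have hKM u : K u -> `|u| <= M2 + 1 by move=> Ku; apply: hM2 => //; rewrite ltrDl.
pose M := Num.max (Num.max M1 (M2 + 1)) (Num.max Lam `|l0|).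
have [L [C [L0 H]]] := continuous_dependence hf M.
pose E := expR (C * tau).
have E0 : 0 < E by exact: expR_gt0.
pose X := (n%:R + L ^+ 2) * E.
have X0 : 0 <= X by rewrite mulr_ge0 ?addr_ge0 ?sqr_ge0 ?ler0n // ltW.
(* The shadowing error is at most [e ^+ 2 * X]; since [e <= 1] this is at most [e * X], which is
   smaller than [(d / 2) ^+ 2]. *)
pose e := Num.min 1 ((d / 2) ^+ 2 / (X + 1)).
have X1 : 0 < X + 1 by rewrite ltr_wpDl.
have e0 : 0 < e by rewrite lt_min ltr01 divr_gt0 // exprn_gt0.
have [T3 [_ hT3]] : \forall t \near +oo, `|l0 - l t| < e by apply: cvgr_dist_lt.
pose b := Num.max (Num.max T a) T3.
have [|y [[t bt <-] qt]] := clq [set y | exists2 t, b < t & z t = y] (ball q e) _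
  (nbhsx_ballx q e e0).
- exists b; split; first exact: num_real.
  by move=> t bt; exists t.
have {qt} qt : `|q - z t| < e by move: qt; rewrite -ball_normE.
have [Tt at_ T3t] : [/\ T <= t, a <= t & T3 < t].
  by move: bt; rewrite !gt_max => /andP[/andP[/ltW -> /ltW ->] ->].
exists (t + tau); first by rewrite ler_wpDr.
have := H 0 tau e (fun s => z (t + s)) x (fun s => l (t + s)) (fun _ => l0) tau0 (ltW e0).
rewrite addr0 subr0 -/E => {}H.
have {}H : dot (z (t + tau) - x tau) (z (t + tau) - x tau) <=
    (dot (z t - x 0) (z t - x 0) + (L * e) ^+ 2) * E.
  apply: H => // s /andP[s0 stau].
  - by apply: is_derive_translate; apply: dz; rewrite ler_wpDr.
  - by rewrite !le_max (hKM _ (zK _ _)) ?orbT // ler_wpDr.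
  - by rewrite !le_max hM1 // s0.
  - by rewrite !le_max lb !orbT.
  - by rewrite !le_max lexx !orbT.
  - by rewrite distrC; apply/ltW/hT3; rewrite ltr_wpDr.
have small : dot (z (t + tau) - x tau) (z (t + tau) - x tau) < (d / 2) ^+ 2.
  apply: le_lt_trans H _.
  have h1 : dot (z t - x 0) (z t - x 0) <= n%:R * e ^+ 2.
    apply: le_trans (dot_le_norm _ _) _; rewrite ler_wpM2l // expr2 x0 distrC.
    by apply: ler_pM => //; exact: ltW.
  have e1 : e ^+ 2 <= e by rewrite expr2 ler_piMr ?(ltW e0) // /e ge_min lexx.
  have e2 : e * (X + 1) <= (d / 2) ^+ 2 by rewrite -ler_pdivlMr // /e ge_min lexx orbT.
  have h2 : (dot (z t - x 0) (z t - x 0) + (L * e) ^+ 2) * E <= e ^+ 2 * X.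
    rewrite (_ : e ^+ 2 * X = (n%:R * e ^+ 2 + (L * e) ^+ 2) * E); last by rewrite /X; ring.
    by rewrite ler_wpM2r ?(ltW E0) // lerD2r.
  apply: le_lt_trans h2 _; apply: lt_le_trans e2.
  by apply: (@le_lt_trans _ _ (e * X)); [rewrite ler_wpM2r|rewrite mulrDr mulr1 ltrDl].
have close : `|z (t + tau) - x tau| < d / 2.
  rewrite -(ltr_pXn2r (_ : 0 < 2)%N) ?nnegrE ?(ltW d2) //.
  exact: le_lt_trans (norm_sqr_le_dot _) small.
rewrite -(subrKA (x tau)) (le_lt_trans (ler_normD _ _)) //.
by rewrite (splitr d) ltrD // xtau.
Qed.

(** One sufficiently late visit to the neighbourhood provided by [attract_near] is enough, and
    [basin_approach] supplies it. *)
Lemma basin_convergence (l0 Lam a : R) (p : 'rV[R]_n) (l : R -> R)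
    (K : set 'rV[R]_n) (z : R -> 'rV[R]_n) :
  attracting_hyperbolic_equilibrium f l0 p ->
  l t @[t --> +oo] --> l0 -> (forall t, `|l t| <= Lam) ->
  compact K -> K `<=` basin f l0 p ->
  (forall t : R, a <= t -> is_derive t (1 : R) z (f (z t, l t))) ->
  (forall t, a <= t -> K (z t)) -> z t @[t --> +oo] --> p.
Proof.
move=> hp ll0 lb cK Kb dz zK.
have [d [T [d0 H]]] := attract_near hf hp ll0 ltr01.
have [t] := basin_approach ll0 lb cK Kb dz zK (Num.max T a) d0.
rewrite ge_max => /andP[Tt at_] zt.
by have [] := H t z _ Tt (fun s ts => dz s (le_trans at_ ts)) (fun s _ _ => erefl) zt.
Qed.

End OmegaLimit.

(** * Forward invariance of the inflowing sets *)

Section Trapping.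
Variables (R : realType) (n : nat) (f : 'rV[R]_n * R -> 'rV[R]_n).
Hypothesis hf : continuously_differentiable f.
Variables (lam : R -> R) (r Lam : R).
Hypothesis lamb : forall s, `|lam s| <= Lam.
Variable K : R -> set 'rV[R]_n.
Hypotheses (Kcl : forall s, closed (K s))
  (Kinc : forall s1 s2, s1 < s2 -> K s1 `<=` K s2)
  (Kflow : forall s x, boundary (K s) x -> exists2 t0 : R, 0 < t0 &
     forall t, s < t < s + t0 -> flow_exists (ramped f lam r) s x t /\
       interior (K s) (flow (ramped f lam r) s x t)).

(** Real induction on time. Monotonicity and closedness carry membership to the limit time [t]. From
    there, continuity handles an interior point and the inflow condition a boundary point; in both
    cases [z] stays in [K t] for a while, hence in the larger later sets. The strict bound [M]
    identifies [z] with the flow of the true equation. *)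
Lemma trapped (M a : R) (z : R -> 'rV[R]_n) :
  (forall s x, K s x -> `|x| < M) -> cutoff_solution f lam r M z -> K a (z a) ->
  forall t, a <= t -> K t (z t).
Proof.
move=> KM dz Ka; apply: real_induction => t at_ IH.
have cz s : {for s, continuous z} by exact: is_derive_continuous (dz s).
have Kt : K t (z t).
  move: at_; rewrite le_eqVlt => /orP[/eqP <- //|at_].
  have h : forall s, a <= s < t -> K t (z s).
    by move=> s /[dup] /IH + /andP[_ st]; exact: Kinc.
  exact: closed_left_limit (@Kcl t) (cz t) at_ h.
split=> //.
have [e1 e10 h1] : exists2 e : R, 0 < e & forall s, t <= s < t + e -> `|z s| < M.
  have : nbhs t [set s | `|z s| < M].
    have ct : `|z s| @[s --> t] --> `|z t| by apply: cvg_norm; exact: cz.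
    by apply: (cvgr_lt _ ct); exact: KM Kt.
  move=> /nbhs_ballP[e e0 he]; exists e => // s /andP[ts ste]; apply: he.
  by rewrite /ball /= distrC ger0_norm ?subr_ge0 // ltrBlDl.
have [iK|niK] := pselect (interior (K t) (z t)).
  have : nbhs t [set s | K t (z s)] by exact: (cz t).
  move=> /nbhs_ballP[e e0 he]; exists e => // s /andP[ts ste].
  apply: (Kinc ts); apply: he.
  by rewrite /ball /= ltr0_norm ?subr_lt0 // opprB ltrBlDl.
have bK : boundary (K t) (z t) by split => //; exact: subset_closure.
have [e2 e20 h2] := Kflow bK.
exists (Num.min e1 e2); first by rewrite lt_min e10.
move=> s /andP[ts]; rewrite -ltrBlDl lt_min => /andP[s1 s2].
apply: (Kinc ts); apply: interior_subset.
have ts' := ltW ts.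
suff E : flow (ramped f lam r) t (z t) s = z s.
  by rewrite -E; apply: (h2 s _).2; rewrite ts -ltrBlDl.
apply: (flow_unique hf lamb ts'); apply: (reaches_cutoff ts' dz) => u /andP[tu us].
apply: h1; rewrite tu /=; apply: le_lt_trans us _.
by rewrite -ltrBlDl.
Qed.

End Trapping.

Section Ramped.
Variables (R : realType) (n : nat) (f : 'rV[R]_n * R -> 'rV[R]_n).
Hypothesis hf : continuously_differentiable f.
Variables (lam : R -> R) (r Lam : R).
Hypothesis lamb : forall s, `|lam s| <= Lam.

(** By uniqueness [g] and [z] agree from [b] on where both are defined, so following [g] up to an
    intermediate time [c] and [z] afterwards gives a solution on the whole line that extends [g].
    Maximality then leaves no other domain. *)
Lemma maximal_solution_total (D : set R) (g z : R -> 'rV[R]_n) (a b : R) :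
  maximal_solution (ramped f lam r) D g -> `]-oo, a[ `<=` D -> b < a ->
  (forall t : R, b <= t -> is_derive t (1 : R) z (f (z t, lam (r * t)))) ->
  z b = g b -> D = [set: R] /\ forall t, b <= t -> g t = z t.
Proof.
move=> [[oD iD dg] maxD] aD ba dz zb.
have Da t : t < a -> D t by move=> ta; apply: aD; rewrite /= in_itv.
have gz t : b <= t -> D t -> g t = z t.
  move=> bt Dt; apply: (@ode_unique _ _ _ hf (fun t => lam (r * t)) Lam b t) => //.
  - by move=> s bst; apply: dg; exact: iD (Da b ba) Dt _ bst.
  - by move=> s /andP[bs _]; exact: dz.
pose c := (a + b) / 2.
have [bc ca] : b < c /\ c < a by rewrite /c; split; lra.
pose y t := if t < c then g t else z t.
have yg t : D t -> y t = g t.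
  rewrite /y => Dt; case: ltP => // ct; rewrite gz //.
  exact: le_trans (ltW bc) ct.
have dy t : is_derive t (1 : R) y (f (y t, lam (r * t))).
  have [tc|ct] := ltP t c.
    have Dt : D t by apply: Da; exact: lt_trans ca.
    rewrite yg //; apply: near_eq_is_derive (dg t Dt).
    by near=> s; rewrite /y ifT //; near: s; exact: lt_nbhsl.
  have -> : y t = z t by rewrite /y ltNge ct.
  apply: near_eq_is_derive (dz t _); last exact: le_trans (ltW bc) ct.
  have : \forall s \near t, b < s by apply: lt_nbhsr; exact: lt_le_trans ct.
  apply: filterS => s bs; rewrite /y; case: ltP => // sc.
  by rewrite gz ?(ltW bs) //; apply: Da; exact: lt_trans ca.
have DT : [set: R] = D.
  apply: (maxD _ y) => //; split; [exact: openT | by [] | by move=> t _; exact: dy].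
by split=> // t bt; apply: gz => //; rewrite -DT.
Unshelve. all: by end_near. Qed.

(** Clamping makes the Lipschitz constant global, so a perturbed solution can be estimated before it
    is known to be bounded. *)
Lemma cutoff_gronwall (M : R) : 0 <= M -> exists2 C, 0 <= C &
  forall (z w : R -> 'rV[R]_n) (a b : R), a <= b ->
  (forall t, a <= t <= b -> is_derive t (1 : R) z (f (clamp M (z t), lam (r * t)))) ->
  (forall t, a <= t <= b -> is_derive t (1 : R) w (f (clamp M (w t), lam (r * t)))) ->
  dot (z b - w b) (z b - w b) <=
    dot (z a - w a) (z a - w a) * expR (C * (b - a)).
Proof.
move=> M0; have [L L0 hL] := lipschitz_ball hf (Num.max M Lam).
exists (n%:R * (2 * L + 1)); first by rewrite mulr_ge0 // addr_ge0 // mulr_ge0.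
move=> z w a b ab dz dw.
have := @gronwall_rV _ _ (fun t => z t - w t)
  (fun t => f (clamp M (z t), lam (r * t)) - f (clamp M (w t), lam (r * t)))
  L 0 a b L0 (lexx 0) ab.
rewrite expr0n /= addr0; apply=> t tab.
  exact: is_deriveB (dz t tab) (dw t tab).
have cM (x : 'rV[R]_n) : `|clamp M x| <= Num.max M Lam by rewrite le_max norm_clamp.
have lM : `|lam (r * t)| <= Num.max M Lam by rewrite le_max lamb orbT.
apply: le_trans (hL _ _ _ _ (cM _) (cM _) lM lM) _.
rewrite subrr normr0 (max_idPl _) // addr0 ler_wpM2l //.
exact: clamp_lipschitz.
Qed.

Lemma cutoff_forward_attracted (M t0 : R) (p : 'rV[R]_n) (z g : R -> 'rV[R]_n) :
  cutoff_solution f lam r M z -> (forall t, t0 <= t -> `|z t| < M) ->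
  z t @[t --> +oo] --> p -> g t @[t --> +oo] --> p ->
  (forall s, t0 <= s -> flow_exists (ramped f lam r) t0 (z t0) s) /\
  `|flow (ramped f lam r) t0 (z t0) s - g s| @[s --> +oo] --> (0 : R).
Proof.
move=> dz zM zp gp.
have reach s : t0 <= s -> reaches (ramped f lam r) t0 (z t0) s (z s).
  by move=> ts; apply: (reaches_cutoff ts dz) => u /andP[tu _]; exact: zM.
split; first by move=> s /reach h; exists (z s).
have H : `|z s - g s| @[s --> +oo] --> (0 : R).
  by rewrite -(normr0 'rV[R]_n) -(subrr p); apply: cvg_norm; exact: cvgB.
apply: cvg_trans H; apply: near_eq_cvg; exists t0; split; first exact: num_real.
by move=> s ts; rewrite (flow_unique hf lamb (ltW ts) (reach _ (ltW ts))).
Qed.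

End Ramped.

Lemma parameter_shift_bounded (R : realType) (lm lp : R) (lam : R -> R) :
  parameter_shift lm lp lam -> continuous lam /\
  forall s, `|lam s| <= Num.max `|lm| `|lp|.
Proof.
case=> [[dl _] bl _ _]; split.
  by move=> s; apply: differentiable_continuous; exact/derivable1_diffP.
move=> s; have /andP[/ltW h1 /ltW h2] := bl s.
rewrite le_max; have [l0|l0] := leP 0 (lam s).
  by rewrite [X in _ || X](_ : _ = true) ?orbT // ger0_norm // (le_trans h2) ?ler_norm.
by rewrite (_ : `|lam s| <= `|lm|) // ltr0_norm // -normrN (le_trans _ (ler_norm _)) // lerN2.
Qed.

(** * End-point tracking and forward attraction of the pullback attractor *)

Theorem proposition1 (R : realType) (N : nat) (hN : (1 < N)%N)
    (f : 'rV[R]_N * R -> 'rV[R]_N) (hf : continuously_differentiable f)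
    (lm lp : R) (lam : R -> R) (hlam : parameter_shift lm lp lam)
    (X : R -> 'rV[R]_N) (Xm Xp : 'rV[R]_N)
    (hX : stable_path f lam lm lp X Xm Xp)
    (hK : forward_inflowing_stable f lam lp X Xm Xp) :
  forall r : R, 0 < r ->
  forall (D : set R) (gamma : R -> 'rV[R]_N),
    pullback_attractor f lam r Xm D gamma ->
    [/\ D = [set: R],
        endpoint_tracking X r gamma,
        gamma t @[t --> +oo] --> Xp &
        forward_attracting (ramped f lam r) gamma].
Proof.
move=> r r0 D gamma [maxg [a0 Da0] gXm _].
have [lamc lamb] := parameter_shift_bounded hlam.
set Lam := Num.max _ _ in lamb.
have [_ _ [_ Xcv] _ hXp] := hX.
have ry : r * t @[t --> +oo] --> +oo by apply: gt0_cvgMry => //; exact: cvg_id.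
have lcv : lam (r * t) @[t --> +oo] --> lp.
  by case: hlam => _ _ [_ lamcv] _; exact: cvg_comp ry lamcv.
have Xrcv : X (r * t) @[t --> +oo] --> Xp by exact: cvg_comp ry Xcv.
have lb t : `|lam (r * t)| <= Lam by [].
have [K [cK [_ Kinc Kflow [KmXm _] [Kpb cKp]]]] := hK.
set Km := \bigcap_s K s in KmXm; set Kp := closure _ in Kpb cKp.
have Kcl s : closed (K s) by exact: compact_closed.
have KKp s : K s `<=` Kp by move=> x Kx; apply: subset_closure; exists s.
have [B B0 KpB] : exists2 B, 0 <= B & forall x, Kp x -> `|x| <= B.
  have [M0 [_ hM0]] := compact_bounded cKp.
  exists (Num.max (M0 + 1) 0); first by rewrite le_max lexx orbT.
  by move=> x Kx; apply: hM0 => //; rewrite lt_max ltrDl ltr01.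
(* The margin over the bound [B] of [Kp] exceeds one, so points within one of [gamma] or of [Xp] are
   not moved by clamping. *)
pose M := B + 2.
have M0 : 0 <= M by rewrite addr_ge0.
have KM s x : K s x -> `|x| < M.
  by move=> /KKp/KpB xB; rewrite (le_lt_trans xB) // ltrDl.
have [e e0 heKm] : exists2 e, 0 < e & forall x, `|Xm - x| < e -> Km x.
  by move: KmXm => /nbhs_normP[e e0 he]; exists e.
(* Half of the radius around [Xm] is reserved for the distance from [gamma] to [Xm], the other half
   for the perturbation [xi]. *)
pose d1 := e / 2.
have d10 : 0 < d1 by rewrite divr_gt0.
have [a1 [_ ha1]] : \forall t \near -oo, `|Xm - gamma t| < d1 by apply: cvgr_dist_lt.
pose a := Num.min a0 a1 - 1.
have [aa0 aa1] : a < a0 /\ a < a1.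
  have : a < Num.min a0 a1 by rewrite ltrBlDr ltrDl.
  by rewrite lt_min => /andP[].
have early t xi s : t <= a -> `|xi| < d1 -> K s (gamma t + xi).
  move=> ta xid; suff : Km (gamma t + xi) by apply.
  apply: heKm; rewrite opprD addrA (le_lt_trans (ler_normB _ _)) //.
  by rewrite (splitr e) ltrD // ha1 // (le_lt_trans ta).
have early0 t s : t <= a -> K s (gamma t).
  by move=> ta; rewrite -[gamma t]addr0; apply: early; rewrite ?normr0.
have trap t0 z : cutoff_solution f lam r M z -> K t0 (z t0) ->
    forall t, t0 <= t -> K t (z t).
  by move=> dz; exact: (trapped hf lamb Kcl Kinc (Kflow r r0) KM dz).
(* The clamped solution restarted on [gamma] at an early time is trapped, hence bounded, hence a
   true solution; this makes [gamma] global and keeps it in every [K t]. *)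
have [z za dz] := cutoff_exists hf r lamc lamb (a - 1) (gamma (a - 1)) M0.
have a1a : a - 1 <= a by rewrite lerBlDr lerDl.
have Kz t : a - 1 <= t -> K t (z t).
  by apply: trap => //; rewrite za; exact: early0.
have dz' t : a - 1 <= t -> is_derive t (1 : R) z (f (z t, lam (r * t))).
  by move=> /Kz/KM/ltW zM; have := dz t; rewrite clamp_id.
have [DT gz] := maximal_solution_total hf lamb maxg Da0
  (le_lt_trans a1a aa0) dz' za.
have Kg t : K t (gamma t).
  have [ta|/ltW at_] := leP t a; first exact: early0.
  by rewrite gz; [apply: Kz|]; exact: le_trans at_.
have dg t : is_derive t (1 : R) gamma (f (gamma t, lam (r * t))).
  by have [[_ _ dg] _] := maxg; apply: dg; rewrite DT.
have conv t0 w : (forall t : R, t0 <= t -> is_derive t (1 : R) w (f (w t, lam (r * t)))) ->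
    (forall t, t0 <= t -> K t (w t)) -> w t @[t --> +oo] --> Xp.
  move=> dw Kw; apply: (basin_convergence hf hXp lcv lb cKp Kpb dw) => t /Kw.
  exact: KKp.
have gcv : gamma t @[t --> +oo] --> Xp.
  exact: (conv 0 gamma (fun t _ => dg t) (fun t _ => Kg t)).
split => //.
  rewrite /endpoint_tracking -(normr0 'rV[R]_N) -(subrr Xp).
  by apply: cvg_norm; exact: cvgB.
have [d [T [d0 near_Xp]]] := attract_near hf hXp lcv ltr01.
(* Tolerance for shadowing [gamma]: [d / 2] leads into the attracting ball around [Xp], and one
   keeps the perturbed solution inside the cube. *)
pose eta := Num.min (d / 2) 1.
have eta0 : 0 < eta by rewrite lt_min ltr01 divr_gt0.
have [b [Tb ab hb]] : exists b, [/\ T <= b, a <= b &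
    forall t, b <= t -> `|gamma t - Xp| < d / 2].
  have [b0 [_ hb0]] : \forall t \near +oo, `|Xp - gamma t| < d / 2.
    by apply: cvgr_dist_lt => //; rewrite divr_gt0.
  exists (Num.max (Num.max T a) (b0 + 1)); split; rewrite ?le_max ?lexx ?orbT //.
  move=> t bt; rewrite distrC; apply: hb0; apply: lt_le_trans bt.
  by rewrite lt_max ltrDl ltr01 orbT.
have XpB : `|Xp| <= B.
  apply: KpB; have clKp : closed Kp := @closed_closure _ _.
  exact: (closed_cvg Kp clKp (nearW _ (fun t => KKp _ _ (Kg t))) Xp gcv).
have [C C0 cgron] := cutoff_gronwall hf r lamb M0.
pose E := expR (C * (b - a)).
have E1 : 1 <= E by rewrite -expR0 ler_expR mulr_ge0 // subr_ge0.
have E0 : 0 < E by exact: lt_le_trans E1.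
(* The squared error grows to at most [N%:R * d2 ^+ 2 * E], which is below [eta ^+ 2] because
   [N%:R * E * d2 < eta] and [d2 <= eta]. The added one makes the former inequality strict. *)
pose d2 := eta / ((N%:R + 1) * E).
have NE1 : 1 <= (N%:R + 1) * E by rewrite mulr_ege1 // lerDr.
have NE0 : 0 < (N%:R + 1) * E by exact: lt_le_trans NE1.
have d20 : 0 < d2 by rewrite divr_gt0.
have d2eta : d2 <= eta by rewrite ler_pdivrMr // ler_peMr // ltW.
exists (Num.min d1 d2) => [|xi]; first by rewrite lt_min d10.
rewrite lt_min => /andP[xi1 xi2] t0.
have [w w0 dw] := cutoff_exists hf r lamc lamb t0 (gamma t0 + xi) M0.
rewrite -w0.
suff [wM wcv] : (forall t, t0 <= t -> `|w t| < M) /\ w t @[t --> +oo] --> Xp.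
  exact: (cutoff_forward_attracted hf lamb dw wM wcv gcv).
(* An early perturbation still starts in [K t0] and is trapped, so it converges to [Xp] exactly as
   [gamma] does. *)
have [ta|/ltW at0] := leP t0 a.
  have Kw t : t0 <= t -> K t (w t).
    by apply: trap => //; rewrite w0; exact: early.
  split; first by move=> t /Kw; exact: KM.
  apply: (conv t0) => // t /Kw/KM/ltW wM.
  by have := dw t; rewrite clamp_id.
(* This treats intermediate and late starts together: shadowing lasts at most [b - a], and for
   [t0 >= b] the interval from [t0] to [c] is a single point. *)
pose c := Num.max t0 b.
have shadow t : t0 <= t <= c -> `|w t - gamma t| < eta.
  move=> /andP[t0t tc].
  have gron := cgron w gamma t0 t t0t (fun s _ => dw s) _.
  have {}gron : dot (w t - gamma t) (w t - gamma t) <= dot xi xi * expR (C * (t - t0)).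
    have -> : xi = w t0 - gamma t0 by rewrite w0 addrC addKr.
    apply: gron => s _; rewrite clamp_id //; exact/ltW/KM.
  rewrite -(ltr_pXn2r (_ : 0 < 2)%N) ?nnegrE ?(ltW eta0) //.
  apply: le_lt_trans (norm_sqr_le_dot _) _; apply: le_lt_trans gron _.
  have h1 : dot xi xi <= N%:R * d2 ^+ 2.
    apply: le_trans (dot_le_norm _ _) _; rewrite ler_wpM2l // expr2.
    by apply: ler_pM => //; exact: ltW.
  have h2 : expR (C * (t - t0)) <= E.
    rewrite ler_expR ler_wpM2l //; move: tc; rewrite le_max => /orP[]; lra.
  apply: (@le_lt_trans _ _ (N%:R * d2 ^+ 2 * E)).
    by apply: ler_pM => //; exact: dot_ge0.
  have -> : N%:R * d2 ^+ 2 * E = (N%:R * E * d2) * d2 by ring.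
  have h3 : N%:R * E * d2 < eta.
    have -> : eta = (N%:R + 1) * E * d2 by rewrite mulrC divfK ?gt_eqF.
    by rewrite ltr_pM2r // ltr_pM2r // ltrDl.
  apply: (@le_lt_trans _ _ (N%:R * E * d2 * eta)).
    apply: ler_wpM2l => //; apply: mulr_ge0; last exact: ltW.
    by apply: mulr_ge0; [exact: ler0n|exact: ltW].
  by rewrite expr2 ltr_pM2r.
have [t0c bc] : t0 <= c /\ b <= c by rewrite !le_max !lexx orbT.
have wc : `|w c - Xp| < d.
  rewrite -(subrKA (gamma c)) (le_lt_trans (ler_normD _ _)) // (splitr d) ltrD //.
    apply: lt_le_trans (shadow c _) _; first by rewrite t0c lexx.
    by rewrite ge_min lexx.
  exact: hb.
(* From [c] on the local attraction takes over; within distance one of [Xp] the clamped field is the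
   true one. *)
have [|wnear wcv] := near_Xp c w _ (le_trans Tb bc) (fun t _ => dw t) _ wc.
  move=> t _ wt; rewrite clamp_id //.
  rewrite -[w t](subrK Xp) (le_trans (ler_normD _ _)) //.
  by rewrite /M addrC lerD // (le_trans (ltW wt)) // ler1n.
split => // t t0t; have [ct|/ltW tc] := leP c t.
  rewrite -[w t](subrK Xp) (le_lt_trans (ler_normD _ _)) //.
  have := wnear t ct; rewrite /M; lra.
rewrite -[w t](subrK (gamma t)) (le_lt_trans (ler_normD _ _)) //.
have := shadow t (introT andP (conj t0t tc)).
have : `|gamma t| <= B by exact: KpB (KKp _ _ (Kg t)).
have : eta <= 1 by rewrite ge_min lexx orbT.
rewrite /M; lra.
Qed.
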